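(* For every full-dimensional convex polyhedron $P\subset\mathbb R^3$, the square-boundary matrix $\mathsf D_P$ satisfies \[ \ker\mathsf D_P\cong\mathbb Z^{\delta(P)},\qquad \operatorname{coker}\mathsf D_P\cong\mathbb Z^{V(P)-1}\oplus\mathbb Z/2 . \] Equivalently, if $r=A(P)-V(P)+1$, then the nonzero Smith invariant factors of $\mathsf D_P$ are \[ \operatorname{diag}(\underbrace{1,\ldots,1}_{r-1},2). \]
   Context: A convex polyhedron $P\subset\mathbb R^3$ means a compact full-dimensional convex polytope. Two points of $P$ are antipodal if there are two parallel supporting planes of $P$, one through each point, that contain $P$ between them. $V(P)$ is the number of vertices of $P$; $A(P)$ is the number of unordered pairs of distinct vertices of $P$ that are antipodal; $B(P)$ is the number of unordered pairs of distinct edges of $P$ whose midpoints are antipodal. The antipodal defect is $\delta(P)=V(P)-1-A(P)+B(P)$. The antipodal graph $G_A(P)$ has as vertices the vertices of $P$, with an edge $vw$ whenever $v,w$ are distinct antipodal vertices. Let $\mathcal S(P)$ be the set of unordered pairs $\{e,f\}$ of distinct edges of $P$ whose midpoints are antipodal. The antipodal square complex $X(P)$ is the CW complex obtained from $G_A(P)$ by attaching one square 2-cell for each $\{e,f\}\in\mathcal S(P)$: if $e=vv'$ and $f=ww'$, the square is attached along the four-cycle $v-w-v'-w'-v$ (such $e,f$ are disjoint, and the four vertex pairs used are antipodal). After choosing arbitrary orientations of edges and squares, $\mathsf D_P:\mathbb Z^{\mathcal S(P)}\to C_1(G_A(P);\mathbb Z)$ is the cellular boundary map of $X(P)$, whose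 columns are the oriented square boundaries. *)

(* Defs.v *)
From HB Require Import structures.
From mathcomp Require Import all_boot all_order all_algebra finmap.
From mathcomp Require Import generic_quotient ring_quotient.
From mathcomp Require Import boolp classical_sets cardinality reals.

Set Implicit Arguments.
Unset Strict Implicit.
Unset Printing Implicit Defensive.

Import Order.TTheory GRing.Theory Num.Theory.

Local Open Scope classical_set_scope.
Local Open Scope ring_scope.
Local Open Scope quotient_scope.

Definition R3 (R : realType) := 'rV[R]_3.

Definition dot (R : realType) (u x : R3 R) : R := \sum_i u 0 i * x 0 i.

Definition affine_hull (R : realType) (S : set (R3 R)) : set (R3 R) :=
  [set x | exists (n : nat) (t : 'I_n -> R) (p : 'I_n -> R3 R),
     [/\ forall i, S (p i), \sum_i t i = 1 & x = \sum_i t i *: p i]].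

Definition convex_hull (R : realType) (S : set (R3 R)) : set (R3 R) :=
  [set x | exists (n : nat) (t : 'I_n -> R) (p : 'I_n -> R3 R),
     [/\ forall i, S (p i), forall i, 0 <= t i, \sum_i t i = 1
       & x = \sum_i t i *: p i]].

Definition polytope (R : realType) (P : set (R3 R)) : Prop :=
  exists s : seq (R3 R), P = convex_hull [set` s].

Definition full_dimensional (R : realType) (P : set (R3 R)) : Prop :=
  affine_hull P = setT.

(* Proper faces: the intersections of [P] with its supporting planes. *)
Definition face (R : realType) (P F : set (R3 R)) : Prop :=
  F !=set0 /\
  exists (u : R3 R) (c : R),
    [/\ u != 0, forall x, P x -> dot u x <= c
      & F = P `&` [set x | dot u x = c]].

Definition vertices (R : realType) (P : set (R3 R)) : set (R3 R) :=
  [set v | face P [set v]].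

(* An edge, i.e. a face that is a nondegenerate segment, is represented by the
   unordered pair of its endpoints. *)
Definition edges (R : realType) (P : set (R3 R)) : set {fset R3 R} :=
  [set e | exists v w, [/\ v != w, face P (convex_hull [set v; w])
                         & e = [fset v; w]%fset]].

Definition midpoint (R : realType) (e : {fset R3 R}) : R3 R :=
  2^-1 *: \sum_(x <- e) x.

(* The parallel supporting planes are those orthogonal to [u] through [x] and
   through [y]. *)
Definition antipodal (R : realType) (P : set (R3 R)) (x y : R3 R) : Prop :=
  [/\ P x, P y & exists2 u : R3 R, u != 0 &
      forall z, P z -> dot u y <= dot u z <= dot u x].

(* The edges of the antipodal graph. *)
Definition antipodal_pairs (R : realType) (P : set (R3 R)) :
    set {fset R3 R} :=
  [set a | exists v w, [/\ vertices P v, vertices P w, v != w,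
                           antipodal P v w & a = [fset v; w]%fset]].

(* The squares of the antipodal square complex. *)
Definition antipodal_squares (R : realType) (P : set (R3 R)) :
    set {fset {fset R3 R}} :=
  [set s | exists e f, [/\ edges P e, edges P f, e != f,
                           antipodal P (midpoint e) (midpoint f)
                         & s = [fset e; f]%fset]].

(* [fset_set] enumerates a finite set; the three sets below are finite as soon
   as [P] is a polytope. *)
Definition nb_vertices (R : realType) (P : set (R3 R)) : nat :=
  #|` fset_set (vertices P)|%fset.

Definition nb_pairs (R : realType) (P : set (R3 R)) : nat :=
  #|` fset_set (antipodal_pairs P)|%fset.

Definition nb_squares (R : realType) (P : set (R3 R)) : nat :=
  #|` fset_set (antipodal_squares P)|%fset.

Definition defect (R : realType) (P : set (R3 R)) : int :=
  (nb_vertices P)%:Z - 1 - (nb_pairs P)%:Z + (nb_squares P)%:Z.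

(* An orientation of the antipodal graph: [o a = (x, y)] orients [a] from [x]
   to [y]. *)
Definition orients_pairs (R : realType) (P : set (R3 R))
    (o : {fset R3 R} -> R3 R * R3 R) : Prop :=
  forall a, antipodal_pairs P a -> a = [fset (o a).1; (o a).2]%fset.

(* [q s = ((v, v'), (w, w'))] orients the square [s] along the closed walk
   v -> w -> v' -> w' -> v. Exchanging v and v' reverses the walk, so that both
   orientations of every square are obtained. *)
Definition orients_squares (R : realType) (P : set (R3 R))
    (q : {fset {fset R3 R}} ->
         (R3 R * R3 R) * (R3 R * R3 R)) : Prop :=
  forall s, antipodal_squares P s ->
    let: ((v, v'), (w, w')) := q s in s = [fset [fset v; v']; [fset w; w']]%fset.

(* Coefficient of the oriented edge [a] in the step x -> y (for x != y). *)
Definition incidence (R : realType) (a : R3 R * R3 R) (x y : R3 R) :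
    int :=
  (a == (x, y))%:R - (a == (y, x))%:R.

Definition square_boundary (R : realType)
    (q : (R3 R * R3 R) * (R3 R * R3 R)) (a : R3 R * R3 R) :
    int :=
  let: ((v, v'), (w, w')) := q in
  incidence a v w + incidence a w v' + incidence a v' w' + incidence a w' v.

Definition boundary_matrix (R : realType) (P : set (R3 R))
    (o : {fset R3 R} -> R3 R * R3 R)
    (q : {fset {fset R3 R}} ->
         (R3 R * R3 R) * (R3 R * R3 R)) :
    'M[int]_(nb_pairs P, nb_squares P) :=
  \matrix_(i, j)
    square_boundary (q (nth fset0 (fset_set (antipodal_squares P)) j))
                    (o (nth fset0 (fset_set (antipodal_pairs P)) i)).

(* A matrix [D : 'M[int]_(m, n)] acts on column vectors, Z^n -> Z^m. *)
Definition ker_pred (m n : nat) (D : 'M[int]_(m, n)) : {pred 'cV[int]_n} :=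
  fun x => D *m x == 0.

Lemma ker_pred_closed (m n : nat) (D : 'M[int]_(m, n)) :
  zmod_closed (ker_pred D).
Proof.
split=> [|x y]; rewrite !unfold_in /ker_pred ?mulmx0 //.
by move=> /eqP x0 /eqP y0; rewrite mulmxBr x0 y0 subr0.
Qed.

HB.instance Definition _ (m n : nat) (D : 'M[int]_(m, n)) :=
  GRing.isZmodClosed.Build 'cV[int]_n (ker_pred D) (ker_pred_closed D).

Definition ker (m n : nat) (D : 'M[int]_(m, n)) := {x | x \in ker_pred D}.

HB.instance Definition _ (m n : nat) (D : 'M[int]_(m, n)) :=
  Choice.on (ker D).
HB.instance Definition _ (m n : nat) (D : 'M[int]_(m, n)) :=
  SubChoice.on (ker D).
HB.instance Definition _ (m n : nat) (D : 'M[int]_(m, n)) :=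
  [SubChoice_isSubZmodule of ker D by <:].

Definition im_pred (m n : nat) (D : 'M[int]_(m, n)) : {pred 'cV[int]_m} :=
  fun y => `[< exists x : 'cV[int]_n, y = D *m x >].

Lemma im_pred_closed (m n : nat) (D : 'M[int]_(m, n)) :
  zmod_closed (im_pred D).
Proof.
split=> [|x y].
  by apply/asboolP; exists 0; rewrite mulmx0.
move=> /asboolP[a ->] /asboolP[b ->]; apply/asboolP.
by exists (a - b); rewrite mulmxBr.
Qed.

HB.instance Definition _ (m n : nat) (D : 'M[int]_(m, n)) :=
  GRing.isZmodClosed.Build 'cV[int]_m (im_pred D) (im_pred_closed D).

Definition coker (m n : nat) (D : 'M[int]_(m, n)) : zmodType :=
  Quotient.quot (im_pred D).

Definition zmod_isomorphic (U V : zmodType) : Prop :=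
  exists f : {additive U -> V}, bijective f.

(* [d] lists the nonzero invariant factors of [D]: [D] is equivalent over the
   integers to the rectangular diagonal matrix carrying [d] followed by zeros. *)
Definition nonzero_invariant_factors (m n : nat) (D : 'M[int]_(m, n))
    (d : seq int) : Prop :=
  [/\ (size d <= minn m n)%N, all (fun k => 0 < k) d, sorted dvdz d
    & exists (L : 'M[int]_m) (N : 'M[int]_n),
        [/\ L \in unitmx, N \in unitmx
          & D = L *m (\matrix_(i, j) (d`_i *+ (i == j :> nat))) *m N]].

(* Main.v *)
From HB Require Import structures.
Require Import Defs.
From mathcomp Require Import all_boot all_order all_algebra finmap.
From mathcomp Require Import generic_quotient ring_quotient.
From mathcomp Require Import boolp classical_sets cardinality reals.
From mathcomp Require Import ring lra zify.

(* Let [A u] be the set of vertices of [P] maximising a direction [u != 0].  A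
   cochain [phi] on ordered antipodal pairs that is flat on all antipodal squares
   is flat on every [A u] x [A (- u)].  Hence, for [v] and [x] in a common [A u],
   the difference [phi v w - phi x w] with [w] in [A (- u)] does not depend on
   [u] and [w].  It is a cocycle on the boundary of [P], hence exact since a
   sphere is simply connected, and this splits [phi v w] as [a v + b w].  For a
   cochain of the unoriented antipodal graph, [phi w v = - phi v w] forces
   [phi v w = a v - a w + tau] with [2 tau = 0].

   Applied to the tautological cochain with values in the cokernel of the
   square-boundary matrix, this shows that a 1-chain is a combination of square
   boundaries as soon as it is a cycle of even length.  As the antipodal graph is
   connected and has an odd closed walk, the cokernel is [Z^(V - 1) + Z/2], and
   its torsion determines the Smith form.

   All connectivity statements, and the exactness on the sphere, come from one
   argument: along a segment of directions the maximiser changes only between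
   points that are maximal simultaneously. *)

Set Implicit Arguments.
Unset Strict Implicit.
Unset Printing Implicit Defensive.

Import Order.TTheory GRing.Theory Num.Theory.

Local Open Scope ring_scope.

(** * Normal directions of a point configuration *)

Section DotProduct.
Variable R : realType.
Implicit Types u v x y n d : R3 R.

Lemma dotE u x :
  dot u x = u 0 0 * x 0 0 + u 0 1 * x 0 1 + u 0 (lift 0 1) * x 0 (lift 0 1).
Proof.
rewrite /dot !big_ord_recl big_ord0 addr0 addrA.
by do ![congr (_ + _)]; congr (u 0 _ * x 0 _); apply: val_inj.
Qed.

Lemma R3P u v : u 0 0 = v 0 0 -> u 0 1 = v 0 1 ->
  u 0 (lift 0 1) = v 0 (lift 0 1) -> u = v.
Proof.
move=> e0 e1 e2; apply/rowP=> -[[|[|[|//]]] i3].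
- by rewrite (_ : Ordinal i3 = 0); last exact: val_inj.
- by rewrite (_ : Ordinal i3 = 1); last exact: val_inj.
- by rewrite (_ : Ordinal i3 = lift 0 1); last exact: val_inj.
Qed.

Lemma dotC u x : dot u x = dot x u.
Proof. by rewrite !dotE; ring. Qed.

Lemma dotDl u v x : dot (u + v) x = dot u x + dot v x.
Proof. by rewrite !dotE !mxE; ring. Qed.

Lemma dotZl a u x : dot (a *: u) x = a * dot u x.
Proof. by rewrite !dotE !mxE; ring. Qed.

Lemma dotNl u x : dot (- u) x = - dot u x.
Proof. by rewrite !dotE !mxE; ring. Qed.

Lemma dotBl u v x : dot (u - v) x = dot u x - dot v x.
Proof. by rewrite dotDl dotNl. Qed.

Lemma dotDr u x y : dot u (x + y) = dot u x + dot u y.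
Proof. by rewrite ![dot u _]dotC dotDl. Qed.

Lemma dotZr a u x : dot u (a *: x) = a * dot u x.
Proof. by rewrite ![dot u _]dotC dotZl. Qed.

Lemma dotBr u x y : dot u (x - y) = dot u x - dot u y.
Proof. by rewrite ![dot u _]dotC dotBl. Qed.

Lemma dot0l x : dot 0 x = 0.
Proof. by rewrite -(scale0r 0) dotZl mul0r. Qed.

Lemma dot0r x : dot x 0 = 0.
Proof. by rewrite dotC dot0l. Qed.

Lemma dot_sumr u m (t : 'I_m -> R) (p : 'I_m -> R3 R) :
  dot u (\sum_i t i *: p i) = \sum_i t i * dot u (p i).
Proof.
elim/big_rec2: _ => [|i a b _ <-]; first by rewrite dot0r.
by rewrite dotDr dotZr.
Qed.

Lemma dotuu_eq0 u : (dot u u == 0) = (u == 0).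
Proof.
apply/eqP/eqP=> [|->]; last exact: dot0l.
rewrite dotE => e; apply: R3P; rewrite !mxE; nra.
Qed.

Lemma dotuu_gt0 u : u != 0 -> 0 < dot u u.
Proof.
move=> u0; rewrite lt_neqAle eq_sym dotuu_eq0 u0 /= dotE.
by rewrite -!expr2 !addr_ge0 // sqr_ge0.
Qed.

Definition cross u v : R3 R :=
  \row_i [:: u 0 1 * v 0 (lift 0 1) - u 0 (lift 0 1) * v 0 1;
             u 0 (lift 0 1) * v 0 0 - u 0 0 * v 0 (lift 0 1);
             u 0 0 * v 0 1 - u 0 1 * v 0 0]`_i.

Lemma dot_cross u v x y :
  dot (cross u v) (cross x y) = dot u x * dot v y - dot u y * dot v x.
Proof. by rewrite !dotE !mxE /=; ring. Qed.

Lemma cross_crossl u v d : cross (cross u v) d = dot u d *: v - dot v d *: u.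
Proof. by apply: R3P; rewrite !(mxE, dotE) /=; ring. Qed.

Lemma cross_neq0 u v n :
  u != 0 -> dot u n = 0 -> dot v n != 0 -> cross u v != 0.
Proof.
move=> u0 un vn; apply: contraTneq isT => c0.
have /eqP := dot_cross u v u n; rewrite c0 dot0l un mul0r subr0 eq_sym mulf_eq0.
by rewrite dotuu_eq0 (negPf u0) (negPf vn).
Qed.

Lemma cross_eq0 n d : n != 0 -> cross n d = 0 ->
  d = (dot n d / dot n n) *: n.
Proof.
move=> n0 c0; apply: (@scalerI _ _ (dot n n)); first by rewrite dotuu_eq0.
rewrite scalerA mulrCA divff ?dotuu_eq0 // mulr1 (dotC n d); apply/eqP.
by rewrite -subr_eq0 -cross_crossl c0; apply/eqP/R3P; rewrite !mxE /= ?mxE; ring.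
Qed.

Lemma orth2_collinear u v x y : cross u v != 0 -> x != 0 ->
  dot u x = 0 -> dot v x = 0 -> dot u y = 0 -> dot v y = 0 ->
  exists l, y = l *: x.
Proof.
move=> n0 x0 ux vx uy vy; set n := cross u v in n0.
have nP d : dot u d = 0 -> dot v d = 0 -> cross n d = 0.
  by move=> ud vd; rewrite cross_crossl ud vd !scale0r subr0.
have [[a ex] [b ey]] : (exists a, x = a *: n) /\ exists b, y = b *: n.
  by split; [have := cross_eq0 n0 (nP _ ux vx) | have := cross_eq0 n0 (nP _ uy vy)];
    eexists; eassumption.
have a0 : a != 0 by apply: contraNneq x0 => a0; rewrite ex a0 scale0r.
by exists (b / a); rewrite ey ex scalerA divfK.
Qed.

Lemma exists_orth2 u v : exists n, [/\ n != 0, dot u n = 0 & dot v n = 0].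
Proof.
pose M : 'M[R]_(3, 1 + 1) := row_mx u^T v^T.
have kM0 : kermx M != 0.
  rewrite -mxrank_eq0 mxrank_ker -lt0n subn_gt0.
  by rewrite (leq_ltn_trans (rank_leq_col M)).
have /sub_kermxP : (nz_row (kermx M) <= kermx M)%MS by exact: nz_row_sub.
rewrite mul_mx_row => /eqP; rewrite -row_mx0 => /eqP/eq_row_mx[/matrixP eu /matrixP ev].
exists (nz_row (kermx M)); split; first by rewrite nz_row_eq0.
  by have := eu 0 0; rewrite !mxE dotC => <-; apply: eq_bigr => i _; rewrite mxE.
by have := ev 0 0; rewrite !mxE dotC => <-; apply: eq_bigr => i _; rewrite mxE.
Qed.

End DotProduct.

(** * Upper envelopes of finitely many affine functions of one parameter *)

Section Envelope.
Variables (R : realType) (I : eqType) (T : Type).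
Implicit Types (r : seq I) (f : I -> R).

Definition max_on r f (i : I) := (i \in r) && all (fun j => f j <= f i) r.

Lemma max_onP r f i :
  reflect (i \in r /\ forall j, j \in r -> f j <= f i) (max_on r f i).
Proof. by apply: (iffP andP) => -[ir /allP]. Qed.

Lemma exists_max_on r f i : i \in r -> exists j, max_on r f j.
Proof.
elim: r i => // k r IHr i _; case: r IHr => [|l r] IHr.
  by exists k; apply/max_onP; split=> [|j]; rewrite inE // => /eqP->.
have [j /max_onP[jr jm]] := IHr l (mem_head _ _).
have [kj|jk] := leP (f k) (f j); [exists j | exists k]; apply/max_onP.
  split=> [|x]; first by rewrite inE jr orbT.
  by rewrite inE => /predU1P[->|/jm].
split=> [|x]; first exact: mem_head.
rewrite inE => /predU1P[->|/jm xj]; first by [].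
exact: le_trans xj (ltW jk).
Qed.

(* The maximum of the lines [f + tau * g] is walked along from [tau = 0] to
   [tau = +oo]: where the line realising it changes, the old and the new one
   both realise it. *)
Lemma envelope_walk r f g (k : I -> T) i0 i1 :
  (forall tau, 0 <= tau -> forall i j, max_on r (fun x => f x + tau * g x) i ->
     max_on r (fun x => f x + tau * g x) j -> k i = k j) ->
  (forall i j, max_on r g i -> max_on r g j -> k i = k j) ->
  max_on r f i0 -> max_on r g i1 -> k i0 = k i1.
Proof.
move=> kfg kg fi0 gi1.
have {fi0} [t0 t0ge0 ft0] : exists2 tau, 0 <= tau &
    max_on r (fun x => f x + tau * g x) i0.
  exists 0 => //; move: fi0 => /max_onP[? fi0]; apply/max_onP; split=> // j jr.
  by rewrite !mul0r !addr0 fi0.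
(* Induction on the number of lines steeper than the current one. *)
have [N] := ubnP (count (fun y => g i0 < g y) r).
elim: N => // N IHN in i0 t0 t0ge0 ft0 *; rewrite ltnS => leN.
pose Y := [seq y <- r | g i0 < g y].
have /max_onP[i0r mi0] := ft0.
(* If no line is steeper, [i0] already maximises [g]. *)
case: (altP (@nilP _ Y)) => [Y0|].
  apply: kg => //; apply/max_onP; split=> // j jr.
  rewrite leNgt; apply/negP => lj.
  have: j \in Y by rewrite mem_filter lj jr.
  by rewrite Y0.
case EY : Y => [//|y0 Y'] _; have y0Y : y0 \in Y by rewrite EY mem_head.
(* The parameter at which the steeper line of [y] overtakes that of [i0]; the smallest one is the
   next breakpoint. *)
pose rt y := (f i0 - f y) / (g y - g i0).
have [y /max_onP[yY my]] := exists_max_on (fun y => - rt y) y0Y.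
move: (yY); rewrite mem_filter => /andP[gy yr].
have rtP z : z \in Y -> t0 <= rt z.
  rewrite mem_filter => /andP[gz zr]; rewrite ler_pdivlMr ?subr_gt0 //.
  by have := mi0 z zr; lra.
have t1i : max_on r (fun x => f x + rt y * g x) i0.
  apply/max_onP; split=> // z zr; have t01 := rtP _ yY.
  have [gz|gz] := ltP (g i0) (g z); last first.
    have := mi0 z zr; have : 0 <= (rt y - t0) * (g i0 - g z).
      by rewrite mulr_ge0 ?subr_ge0.
    by lra.
  have : rt y <= rt z by rewrite -lerN2 my // mem_filter gz.
  by rewrite [rt z]/rt ler_pdivlMr ?subr_gt0 //; lra.
have t1y : max_on r (fun x => f x + rt y * g x) y.
  have /max_onP[_ mt] := t1i; apply/max_onP; split=> // z /mt /le_trans-> //.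
  have : rt y * (g y - g i0) = f i0 - f y.
    by rewrite /rt divfK // subr_eq0 gt_eqF.
  by lra.
have t1ge0 : 0 <= rt y by exact: le_trans t0ge0 (rtP _ yY).
rewrite (kfg _ t1ge0 _ _ t1i t1y); apply: (IHN _ _ t1ge0 t1y).
apply: leq_trans leN.
have sub z : g y < g z -> g i0 < g z by exact: lt_trans.
rewrite -!size_filter.
have -> : [seq z <- r | g y < g z] = [seq z <- Y | g y < g z].
  rewrite /Y -filter_predI; apply: eq_filter => z /=.
  by case: (boolP (g y < g z)) => //= /sub ->.
rewrite -/Y [size (filter _ Y)]size_filter -(count_predC (fun z => g y < g z) Y).
rewrite -addn1 leq_add2l -has_count; apply/hasP; exists y => //=.
by rewrite ltxx.
Qed.

End Envelope.

(** * Perturbations preserving finitely many strict inequalities *)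

Section Perturbation.
Variables (R : realFieldType) (I : eqType).
Implicit Types (r : seq I) (f g : I -> R).

(** If [M] bounds [- g / f] wherever [f] is positive, then [e = 1 / (M + 1)] works. *)
Lemma exists_small_scale r f g :
  exists2 e, 0 < e & forall x, x \in r -> 0 < f x -> 0 < f x + e * g x.
Proof.
have [M M0 MP] : exists2 M, 0 <= M &
    forall x, x \in r -> 0 < f x -> - g x <= M * f x.
  elim: r => [|y r [M M0 MP]]; first by exists 0.
  exists (M + `|g y| / `|f y|); first by rewrite addr_ge0 // divr_ge0.
  move=> x; rewrite inE => /predU1P[->|xr] fx.
    rewrite mulrDl (gtr0_norm fx) divfK ?gt_eqF //.
    have : 0 <= M * f y by rewrite mulr_ge0 // ltW.
    by have := ler_norm (- g y); rewrite normrN; lra.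
  have : 0 <= `|g y| / `|f y| * f x by rewrite mulr_ge0 ?divr_ge0 // ltW.
  by have := MP x xr fx; lra.
have M1 : 0 < M + 1 by lra.
exists (M + 1)^-1 => [|x xr fx]; first by rewrite invr_gt0.
rewrite -(pmulr_rgt0 _ M1) mulrDr mulrA divff ?gt_eqF // mul1r.
by have := MP x xr fx; lra.
Qed.

End Perturbation.

(** * Maximisers, vertices and edges of a finite set of points *)

Section PointConfiguration.
Variables (R : realType) (s : seq (R3 R)).
Implicit Types u h k v w x y z n : R3 R.

Definition mx u x := max_on s (dot u) x.

Definition exposes k v :=
  v \in s /\ forall y, y \in s -> y != v -> dot k y < dot k v.

Definition vtx v := exists k, exposes k v.

Lemma mx_mem u x : mx u x -> x \in s.
Proof. by case/andP. Qed.

Lemma mx_le u x y : mx u x -> y \in s -> dot u y <= dot u x.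
Proof. by move=> /max_onP[_]; apply. Qed.

Lemma mx_eq u x y : mx u x -> mx u y -> dot u x = dot u y.
Proof.
by move=> mx my; apply/le_anti; rewrite !mx_le // (mx_mem mx, mx_mem my).
Qed.

Lemma mx_sub u x y : mx u x -> y \in s -> dot u y = dot u x -> mx u y.
Proof.
by move=> ux ys e; apply/max_onP; split=> // z zs; rewrite e mx_le.
Qed.

Lemma vtx_mem v : vtx v -> v \in s.
Proof. by case=> k []. Qed.

Lemma exposes_mx k v : exposes k v -> mx k v.
Proof.
move=> [vs kv]; apply/max_onP; split=> // y ys.
by have [->//|/kv/ltW->] := eqVneq y v.
Qed.

Lemma mx_exposes k v x : exposes k v -> mx k x -> x = v.
Proof.
move=> [vs kv] kx; apply: contraTeq isT => /(kv _ (mx_mem kx)).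
by rewrite ltNge (mx_le kx).
Qed.

(** For small [e] the strict inequalities for [u] survive and [h] only breaks ties, so the
    maximisers become lexicographic. *)
Lemma exists_perturb u h : exists2 e, 0 < e &
  forall x, mx (u + e *: h) x <-> mx u x /\ forall y, mx u y -> dot h y <= dot h x.
Proof.
have [e e0 eP] := exists_small_scale [seq (x, y) | x <- s, y <- s]
  (fun p => dot u p.1 - dot u p.2) (fun p => dot h p.1 - dot h p.2).
exists e => // x; split=> [ux|[ux hx]].
  have xs := mx_mem ux.
  have uxm : mx u x.
    apply/max_onP; split=> // y ys; rewrite leNgt; apply/negP => lxy.
    have := eP (y, x) (allpairs_f _ ys xs); rewrite /= subr_gt0 => /(_ lxy).
    by have := mx_le ux ys; rewrite !dotDl !dotZl; lra.
  split=> // y uy; have := mx_le ux (mx_mem uy).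
  by rewrite !dotDl !dotZl (mx_eq uxm uy) lerD2l ler_pM2l.
have xs := mx_mem ux.
apply/max_onP; split=> // y ys; rewrite !dotDl !dotZl.
have [lyx|lxy] := ltP (dot u y) (dot u x).
  have := eP (x, y) (allpairs_f _ xs ys); rewrite /= subr_gt0 => /(_ lyx).
  by lra.
have eyx : dot u y = dot u x by apply/le_anti; rewrite lxy mx_le.
by rewrite eyx lerD2l ler_pM2l // hx //; apply: mx_sub ux ys eyx.
Qed.

(** The vectors are treated one by one: when [g] is orthogonal to the new vector [d], a small
    multiple of [d] is added, too small to spoil the earlier ones. *)
Lemma exists_generic (r : seq (R3 R)) :
  exists g, forall n, n \in r -> n != 0 -> dot g n != 0.
Proof.
elim: r => [|d r [g gP]]; first by exists 0.
have [gd|gd] := eqVneq (dot g d) 0; last first.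
  by exists g => n; rewrite inE => /predU1P[->|/gP].
have [e e0 eP] := exists_small_scale r (fun n => `|dot g n|) (fun n => - `|dot d n|).
exists (g + e *: d) => n; rewrite inE dotDl dotZl => /predU1P[->|nr] n0.
  by rewrite gd add0r mulf_neq0 ?dotuu_eq0 // gt_eqF.
apply: contraTneq (eP n nr _) => [/eqP|]; last by rewrite normr_gt0 gP.
rewrite addr_eq0 => /eqP ->; rewrite normrN normrM gtr0_norm //; lra.
Qed.

Lemma exists_separating : exists g, {in s &, injective (dot g)}.
Proof.
have [g gP] := exists_generic [seq x - y | x <- s, y <- s].
exists g => x y xs ys exy; apply/eqP; rewrite -subr_eq0.
apply: contraTT isT => /(gP _ (allpairs_f _ xs ys)).
by rewrite dotBr exy subrr eqxx.
Qed.

(** The dual form of full-dimensionality; it also excludes the empty configuration. *)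
Hypothesis full : forall u, {in s &, forall x y, dot u x = dot u y} -> u = 0.

Lemma s_neq_nil : exists x, x \in s.
Proof.
case: s full => [|x r] H; last by exists x; rewrite mem_head.
have e0 := @H (const_mx 1) (fun x y (xs : x \in [::]) => False_ind _ (notF xs)).
by have /rowP/(_ 0)/eqP := e0; rewrite !mxE oner_eq0.
Qed.

Lemma exists_mx u : exists x, mx u x.
Proof. by have [x xs] := s_neq_nil; apply: exists_max_on xs. Qed.

(** Breaking the ties of [u] by a direction that separates all points leaves a single maximiser. *)
Lemma exists_vtx u : exists2 v, vtx v & mx u v.
Proof.
have [g gi] := exists_separating.
have [e e0 eP] := exists_perturb u g.
have [v wv] := exists_mx (u + e *: g); have [uv gv] := (eP v).1 wv.
exists v => //; exists (u + e *: g); split=> [|y ys yv]; first exact: mx_mem uv.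
rewrite lt_neqAle mx_le // andbT; apply: contraNneq yv => eyv.
have [uy gy] := (eP y).1 (mx_sub wv ys eyv).
apply/eqP/gi => //; first exact: mx_mem uv.
by apply/le_anti; rewrite gv // gy.
Qed.

Lemma exists_vtx_lex u h :
  exists v, [/\ vtx v, mx u v & forall y, mx u y -> dot h y <= dot h v].
Proof.
have [e e0 eP] := exists_perturb u h.
have [v vv /eP[uv hv]] := exists_vtx (u + e *: h).
by exists v.
Qed.

Definition vtxs := [seq v <- s | `[< vtx v >]].

Lemma mem_vtxs v : (v \in vtxs) = `[< vtx v >].
Proof.
by rewrite mem_filter andb_idr // => /asboolP /vtx_mem.
Qed.

Lemma vtxsP v : reflect (vtx v) (v \in vtxs).
Proof. by rewrite mem_vtxs; apply: asboolP. Qed.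

Lemma mx_vtxs u v : max_on vtxs (dot u) v -> mx u v.
Proof.
move=> /max_onP[/vtxsP vv mv]; apply/max_onP; split=> [|y ys].
  exact: vtx_mem vv.
have [w vw uw] := exists_vtx u.
by rewrite (le_trans (mx_le uw ys)) // mv //; apply/vtxsP.
Qed.

Lemma vtxs_mx u v : vtx v -> mx u v -> max_on vtxs (dot u) v.
Proof.
move=> vv uv; apply/max_onP; split=> [|y /vtxsP/vtx_mem]; first exact/vtxsP.
exact: mx_le.
Qed.

Lemma exists_other x : exists2 y, y \in s & y != x.
Proof.
apply: contrapT => noy.
have /rowP/(_ 0)/eqP : (const_mx 1 : R3 R) = 0; last by rewrite !mxE oner_eq0.
apply: full => y z ys zs; suff e t : t \in s -> t = x by rewrite (e y) // (e z).
move=> ts; apply: contrapT => /eqP tx; apply: noy; by exists t.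
Qed.

Lemma exposes_neq0 k v : exposes k v -> k != 0.
Proof.
move=> [vs kv]; have [y ys yv] := exists_other v.
by apply: contraTneq (kv y ys yv) => ->; rewrite !dot0l ltxx.
Qed.

(** Exposing [v] is an open condition, so [k] can be tilted out of the plane orthogonal to [n]. *)
Lemma exists_exposes_off v n : vtx v -> n != 0 ->
  exists2 k, exposes k v & dot k n != 0.
Proof.
move=> [k kv] n0; have [kn|kn] := eqVneq (dot k n) 0; last by exists k.
have [e e0 eP] := exists_perturb k n.
exists (k + e *: n); last first.
  by rewrite dotDl kn add0r dotZl mulf_neq0 ?dotuu_eq0 // gt_eqF.
have wv : mx (k + e *: n) v.
  apply/eP; split=> [|y /(mx_exposes kv) ->//]; exact: exposes_mx.
split=> [|y ys yv]; first exact: mx_mem wv.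
rewrite lt_neqAle mx_le // andbT; apply: contraNneq yv => eyv.
by have [/(mx_exposes kv) -> _] := (eP y).1 (mx_sub wv ys eyv).
Qed.

(* The negative of a direction maximal at [v] is not maximal at [v], as the
   points are not coplanar: segments of normal directions avoid [0]. *)
Lemma mx_segment_neq0 v u1 u2 tau : 0 <= tau -> u1 != 0 ->
  mx u1 v -> mx u2 v -> u1 + tau *: u2 != 0.
Proof.
move=> t0 u10 m1 m2; apply: contra_neq u10 => /eqP; rewrite addr_eq0 => /eqP e.
apply: full => x y xs ys.
suff E z : z \in s -> dot u1 z = dot u1 v by rewrite (E x) // (E y).
move=> zs; apply/le_anti; rewrite mx_le //= e !dotNl !dotZl lerN2.
by rewrite ler_wpM2l // mx_le.
Qed.

Lemma mx_segment v u1 u2 tau : 0 <= tau ->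
  mx u1 v -> mx u2 v -> mx (u1 + tau *: u2) v.
Proof.
move=> t0 m1 m2; apply/max_onP; split=> [|z zs]; first exact: mx_mem m1.
by rewrite !dotDl !dotZl lerD ?ler_wpM2l // mx_le.
Qed.

(* The normal directions run through the segment from [u1] to [u2], up to
   positive factors. *)
Lemma segment_const (T : Type) (g : R3 R -> T) u1 u2 v1 v2 :
  (forall tau, 0 <= tau -> forall x y, vtx x -> vtx y ->
     mx (u1 + tau *: u2) x -> mx (u1 + tau *: u2) y -> g x = g y) ->
  (forall x y, vtx x -> vtx y -> mx u2 x -> mx u2 y -> g x = g y) ->
  vtx v1 -> mx u1 v1 -> vtx v2 -> mx u2 v2 -> g v1 = g v2.
Proof.
move=> g1 g2 vv1 m1 vv2 m2.
have dotE tau : (fun x => dot u1 x + tau * dot u2 x) = dot (u1 + tau *: u2).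
  by apply/funext => x; rewrite dotDl dotZl.
apply: (@envelope_walk _ _ _ vtxs (dot u1) (dot u2)); try exact: vtxs_mx.
  move=> tau t0 i j; rewrite dotE => mi mj; apply: (g1 tau t0).
  - by case/andP: mi => /vtxsP.
  - by case/andP: mj => /vtxsP.
  - exact: mx_vtxs.
  - exact: mx_vtxs.
move=> i j mi mj; apply: g2.
- by case/andP: mi => /vtxsP.
- by case/andP: mj => /vtxsP.
- exact: mx_vtxs.
- exact: mx_vtxs.
Qed.

(** Walk from a direction exposing [v1] to one exposing [v2]. Choosing [u2] not orthogonal to some
    [n] that is orthogonal to [u1] keeps the segment away from [0]. *)
Lemma cofacial_const (T : Type) (g : R3 R -> T) :
  (forall u x y, u != 0 -> vtx x -> vtx y -> mx u x -> mx u y -> g x = g y) ->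
  forall v1 v2, vtx v1 -> vtx v2 -> g v1 = g v2.
Proof.
move=> gP v1 v2 vv1 vv2; have [u1 e1] := vv1.
have [n [n0 u1n _]] := exists_orth2 u1 u1.
have [u2 e2 u2n] := exists_exposes_off vv2 n0.
apply: (@segment_const _ g u1 u2); try exact: exposes_mx; try by [].
  move=> tau t0 x y; apply: gP.
  have [->|tau0] := eqVneq tau 0.
    by rewrite scale0r addr0 (exposes_neq0 e1).
  apply: contraNneq u2n => e; have /eqP : dot (u1 + tau *: u2) n = 0 by rewrite e dot0l.
  rewrite dotDl dotZl u1n add0r.
  by rewrite mulf_eq0 (negPf tau0).
by move=> x y; apply: gP; apply: exposes_neq0 e2.
Qed.

Definition is_edge x y :=
  [/\ x != y, vtx x, vtx y &
    exists w, [/\ w != 0, mx w x, mx w y & forall z, mx w z ->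
      exists2 l, 0 <= l <= 1 & z = x + l *: (y - x)]].

(* Vertices of the face with normal [u] are joined by moving a secondary
   direction [h1 + tau *: h2] that stays independent of [u]; the lexicographic
   maxima then lie on a line. *)
Lemma face_edge_const (T : Type) (g : R3 R -> T) u v1 v2 : u != 0 ->
  (forall x y, is_edge x y -> mx u x -> mx u y -> g x = g y) ->
  vtx v1 -> mx u v1 -> vtx v2 -> mx u v2 -> g v1 = g v2.
Proof.
move=> u0 gP vv1 m1 vv2 m2.
(* [n1] certifies independence from [u] at the start [h1], and [n2], orthogonal to both [u] and
   [h1], does so everywhere else. *)
have [n1 [n10 un1 _]] := exists_orth2 u u.
have [h1 e1 h1n1] := exists_exposes_off vv1 n10.
have [n2 [n20 un2 h1n2]] := exists_orth2 u h1.
have [h2 e2 h2n2] := exists_exposes_off vv2 n20.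
pose r := [seq v <- vtxs | mx u v].
have rP v : reflect (vtx v /\ mx u v) (v \in r).
  by rewrite mem_filter; apply: (iffP andP) => -[] => [? /vtxsP|/vtxsP].
(* Distinct maximisers of [h] on the face span an edge, exposed by a small push of [u] along [h]. *)
have key h x y : cross u h != 0 -> max_on r (dot h) x -> max_on r (dot h) y ->
    g x = g y.
  move=> c0 /max_onP[/rP[vx ux] hx] /max_onP[/rP[vy uy] hy].
  have [->//|xy] := eqVneq x y.
  have exy : dot h x = dot h y.
    by apply/le_anti; rewrite hx ?hy //; apply/rP.
  have [v [vv uv hv]] := exists_vtx_lex u h.
  have evx : dot h v <= dot h x by rewrite hx //; apply/rP.
  have [e e0 eP] := exists_perturb u h.
  have wx : mx (u + e *: h) x.
    by apply/eP; split=> // z /hv /le_trans; apply.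
  have wy : mx (u + e *: h) y.
    by apply/eP; split=> // z /hv; rewrite -exy => /le_trans; apply.
  apply: (gP x y) => //; split=> //; exists (u + e *: h); split=> //.
    apply: contraNneq c0 => /eqP; rewrite addr_eq0 => /eqP ->.
    by apply/eqP/R3P; rewrite !mxE /=; ring.
  move=> z wz; have [uz hz] := (eP z).1 wz.
  have ehz : dot h z = dot h x by apply/le_anti; rewrite hz // (le_trans (hv _ uz)).
  (* Both differences are orthogonal to the independent directions [u] and [h]. *)
  have [l ez] : exists l, z - x = l *: (y - x).
    apply: (orth2_collinear c0); rewrite ?dotBr ?subr_eq0 1?eq_sym //.
    - by rewrite (mx_eq uy ux) subrr.
    - by rewrite exy subrr.
    - by rewrite (mx_eq uz ux) subrr.
    - by rewrite ehz subrr.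
  have ez' : z = x + l *: (y - x) by rewrite -ez addrC subrK.
  (* As [x] and [y] are themselves exposed, [z] cannot lie beyond either of them. *)
  exists l => //; have [kx [xs kxP]] := vx; have [ky [ys kyP]] := vy.
  have zs := mx_mem uz; apply/andP; split.
    rewrite leNgt; apply/negP => l0.
    have zx : z != x.
      by rewrite -subr_eq0 ez scaler_eq0 negb_or lt_eqF // subr_eq0 eq_sym.
    have := kxP z zs zx; have := kxP y ys; rewrite eq_sym => /(_ xy).
    by rewrite ez' dotDr dotZr dotBr; nra.
  rewrite leNgt; apply/negP => l1.
  have zy : z != y.
    rewrite -subr_eq0 (_ : z - y = (l - 1) *: (y - x)).
      by rewrite scaler_eq0 negb_or subr_eq0 gt_eqF // subr_eq0 eq_sym.
    by rewrite ez' scalerBl scale1r opprB; rewrite addrAC addrC addrA.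
  have := kyP z zs zy; have := kyP x xs xy.
  by rewrite ez' dotDr dotZr dotBr; nra.
have dotE tau : (fun x => dot h1 x + tau * dot h2 x) = dot (h1 + tau *: h2).
  by apply/funext => x; rewrite dotDl dotZl.
apply: (@envelope_walk _ _ _ r (dot h1) (dot h2)).
- move=> tau t0 i j; rewrite dotE; apply: key.
  have [->|tau0] := eqVneq tau 0.
    by rewrite scale0r addr0 (cross_neq0 u0 un1).
  by apply: (cross_neq0 u0 un2); rewrite dotDl dotZl h1n2 add0r mulf_neq0.
- by move=> i j; apply: key; apply: (cross_neq0 u0 un2).
- apply/max_onP; split=> [|z /rP[/vtx_mem zs _]]; first exact/rP.
  by rewrite mx_le //; apply: exposes_mx.
- apply/max_onP; split=> [|z /rP[/vtx_mem zs _]]; first exact/rP.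
  by rewrite mx_le //; apply: exposes_mx.
Qed.

End PointConfiguration.

(** * Flat cochains on antipodal pairs *)

Lemma subr_exchange (A : zmodType) (p p' q q' : A) :
  p - p' = q - q' -> p - q = p' - q'.
Proof.
by move=> /(canRL (subrK _)) ->; rewrite addrAC (addrAC q) subrr add0r addrC.
Qed.

Section Cocycles.
Variables (R : realType) (s : seq (R3 R)).
Hypothesis full : forall u, {in s &, forall x y, dot u x = dot u y} -> u = 0.
Variable A : zmodType.
Implicit Types u h k v w x y z n : R3 R.

Local Notation mx := (mx s).
Local Notation vtx := (vtx s).
Local Notation vtxs := (vtxs s).

(** * Exactness of cocycles on the boundary sphere *)

Section Exactness.
Variable c : R3 R -> R3 R -> A.
Hypothesis cD : forall u x y z, u != 0 -> vtx x -> vtx y -> vtx z ->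
  mx u x -> mx u y -> mx u z -> c x y + c y z = c x z.

(** The invariant of the sweep in [cocycle_exact], which adds the vertices in decreasing order along
    [h]. *)
Definition primitive_above h t (a : R3 R -> A) :=
  forall u x y, u != 0 -> vtx x -> vtx y -> mx u x -> mx u y ->
    t < dot h x -> t < dot h y -> c x y = a x - a y.

(* Pushing the normal directions [u + tau *: u'] at [v] along [h] until they
   leave the normal cone of [v] sweeps out the part of the boundary of this
   cone between [u] and [u']. *)
Lemma pivot_const h v a u u' x x' : primitive_above h (dot h v) a -> vtx v ->
  (forall tau t, 0 <= tau -> 0 <= t -> u + tau *: u' + t *: h != 0) ->
  (forall t, 0 <= t -> u' + t *: h != 0) ->
  mx u v -> mx u x -> mx u' v -> mx u' x' -> vtx x -> vtx x' ->
  dot h v < dot h x -> dot h v < dot h x' -> c v x + a x = c v x' + a x'.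
Proof.
move=> aP vv nz1 nz2 uv ux u'v u'x' vx vx' hx hx'.
pose r := [seq y <- vtxs | dot h v < dot h y].
have rP y : reflect (vtx y /\ dot h v < dot h y) (y \in r).
  by rewrite mem_filter; apply: (iffP andP) => -[] => [? /vtxsP|/vtxsP].
(* [- f w y] is the [t] at which [y] ties with [v] in direction [w + t *: h], so maximisers of [f w]
   are the first vertices met. Being linear in [w], [f] fits [envelope_walk]. *)
pose f w y := - (dot w (v - y) / dot h (y - v)).
have hgt0 y : y \in r -> 0 < dot h (y - v).
  by move=> /rP[_]; rewrite dotBr subr_gt0.
have key w i j : mx w v -> (forall t, 0 <= t -> w + t *: h != 0) ->
    max_on r (f w) i -> max_on r (f w) j -> c v i + a i = c v j + a j.
  move=> wv nz /max_onP[ri mi] /max_onP[rj mj].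
  have [vi hi] := rP _ ri; have [vj hj] := rP _ rj.
  pose t := - f w i.
  have t0 : 0 <= t.
    rewrite /t opprK divr_ge0 //; last exact: ltW (hgt0 _ ri).
    by rewrite dotBr subr_ge0 (mx_le wv) // vtx_mem.
  have touch y : y \in r -> f w y = f w i ->
      dot (w + t *: h) y = dot (w + t *: h) v.
    move=> ry ey; have hy := hgt0 _ ry.
    have : t * dot h (y - v) = dot w (v - y).
      by rewrite /t -ey opprK divfK // gt_eqF.
    by rewrite dotDl dotDl !dotZl !dotBr; lra.
  (* At the first tie [v] is still maximal: vertices not above [v] gain nothing on it from [h], and
     those above have not overtaken it. *)
  have Dv : mx (w + t *: h) v.
    apply: mx_vtxs => //; apply/max_onP; split=> [|y /vtxsP vy].
      exact/vtxsP.
    have ys := vtx_mem vy; have wy : dot w y <= dot w v by rewrite (mx_le wv).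
    rewrite !dotDl !dotZl; have [hy|hy] := ltP (dot h v) (dot h y); last first.
      by rewrite lerD // ler_wpM2l.
    have ry : y \in r by apply/rP.
    have : t * dot h (y - v) <= dot w (v - y).
      by rewrite -ler_pdivlMr ?hgt0 // /t -[leRHS]opprK lerN2 mi.
    by rewrite !dotBr; lra.
  have Di : mx (w + t *: h) i by apply: mx_sub Dv (vtx_mem vi) (touch _ ri _).
  have Dj : mx (w + t *: h) j.
    apply: mx_sub Dv (vtx_mem vj) (touch _ rj _).
    by apply/le_anti; rewrite mi // mj.
  have D0 := nz t t0.
  rewrite -(cD D0 vv vi vj Dv Di Dj) (aP _ _ _ D0 vi vj Di Dj hi hj).
  by rewrite -addrA subrK.
have fE tau : (fun y => f u y + tau * f u' y) = f (u + tau *: u').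
  by apply/funext => y; rewrite /f dotDl dotZl mulrN -opprD mulrDl mulrA.
have end_max w y : mx w v -> vtx y -> mx w y -> dot h v < dot h y ->
    max_on r (f w) y.
  move=> wv vy wy hy; apply/max_onP; split=> [|z rz]; first exact/rP.
  rewrite lerN2 [dot w (v - y)]dotBr (mx_eq wv wy) subrr mul0r divr_ge0 //.
    by rewrite dotBr subr_ge0 (mx_le wv) //; case/rP: rz => /vtx_mem.
  exact: ltW (hgt0 _ rz).
apply: (@envelope_walk _ _ _ r (f u) (f u') (fun y => c v y + a y)).
- by move=> tau t0 i j; rewrite fE; apply: key => [|t]; [apply: mx_segment|apply: nz1].
- by move=> i j; apply: key.
- exact: end_max.
- exact: end_max.
Qed.

(* At the lowest vertex the segment from [u] to [u'] may meet the direction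
   [- h]; there [h] is replaced by another direction in general position. *)
Lemma step_const h v a u u' x x' : {in s &, injective (dot h)} ->
  primitive_above h (dot h v) a -> vtx v -> u != 0 -> u' != 0 ->
  mx u v -> mx u x -> mx u' v -> mx u' x' -> vtx x -> vtx x' ->
  dot h v < dot h x -> dot h v < dot h x' -> c v x + a x = c v x' + a x'.
Proof.
move=> hi aP vv u0 u'0 uv ux u'v u'x' vx vx' hx hx'.
(* A point [y] below [v] certifies that no direction vanishes: on [v - y], normal directions at [v]
   are nonnegative and [h] is positive. *)
have [[y ys hy]|nolow] := pselect (exists2 y, y \in s & dot h y < dot h v).
  have key w t : w != 0 -> mx w v -> 0 <= t -> w + t *: h != 0.
    move=> w0 wv t0; have [->|tn0] := eqVneq t 0; first by rewrite scale0r addr0.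
    have {}t0 : 0 < t by rewrite lt0r tn0.
    apply/negP => /eqP/(congr1 (fun z => dot z (v - y))).
    rewrite dot0l dotDl dotZl !dotBr; have := mx_le wv ys; nra.
  apply: (@pivot_const h v a u u') => //.
    by move=> tau t tau0 t0; apply: key => //;
      [apply: mx_segment_neq0 uv u'v|apply: mx_segment].
  by move=> t t0; apply: key.
have neqv y : dot h v < dot h y -> y != v.
  by apply: contraTneq => ->; rewrite ltxx.
have [n [n0 un u'n]] := exists_orth2 u u'.
have [k ek kn] := exists_exposes_off vv n0.
have key w t : w != 0 -> dot w n = 0 -> w + t *: - k != 0.
  move=> w0 wn; have [->|t0] := eqVneq t 0; first by rewrite scale0r addr0.
  apply: contraNneq kn => e; have : dot (w + t *: - k) n = 0 by rewrite e dot0l.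
  by rewrite dotDl wn add0r dotZl dotNl mulrN => /eqP; rewrite oppr_eq0 mulf_eq0 (negPf t0).
(* As [v] is lowest for both [h] and [- k], the vertices above it are the same, and the primitive
   carries over. *)
have above y : vtx y -> dot h v < dot h y <-> dot (- k) v < dot (- k) y.
  move=> vy; have ys := vtx_mem vy; rewrite !dotNl ltrN2; split=> [/neqv|ky].
    by apply: ek.2.
  rewrite ltNge; apply/negP; rewrite le_eqVlt => /predU1P[/hi e|ly].
    by move: ky; rewrite e ?ltxx // vtx_mem.
  by apply: nolow; exists y.
apply: (@pivot_const (- k) v a u u') => //.
- by move=> w y z w0 vy vz wy wz /(above _ vy).2 hy /(above _ vz).2 hz; apply: (aP w).
- move=> tau t tau0 t0; apply: key; first exact: mx_segment_neq0 uv u'v.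
  by rewrite dotDl dotZl un u'n mulr0 addr0.
- by move=> t _; apply: key.
- exact/above.
- exact/above.
Qed.

(** The vertices are added from the highest to the lowest along a separating [h]. Any higher
    cofacial vertex forces the value at the new one, and [step_const] shows that these values
    agree. *)
Lemma cocycle_exact : exists a, forall u x y, u != 0 -> vtx x -> vtx y ->
  mx u x -> mx u y -> c x y = a x - a y.
Proof.
have [h hi] := exists_separating s.
suff H (N : nat) (t : R) : (count (fun v => t < dot h v)%R vtxs < N)%N ->
    exists a, primitive_above h t a.
  have [v /max_onP[vs hv]] : exists v, max_on vtxs (fun v => - dot h v) v.
    have [v0 /vtxsP v0v _] := exists_vtx full 0.
    exact: exists_max_on v0v.
  (* Starting strictly below the lowest vertex makes the height conditions vacuous. *)
  have [a aP] := H _ (dot h v - 1) (ltnSn _); exists a => u x y u0 vx vy ux uy.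
  apply: (aP u) => //.
    by have := hv x; rewrite lerN2 => /(_ (introT (vtxsP _ _) vx)); lra.
  by have := hv y; rewrite lerN2 => /(_ (introT (vtxsP _ _) vy)); lra.
elim: N t => // N IHN t; rewrite ltnS => leN.
pose r := [seq y <- vtxs | t < dot h y].
have rP y : reflect (vtx y /\ t < dot h y) (y \in r).
  by rewrite mem_filter; apply: (iffP andP) => -[] => [? /vtxsP|/vtxsP].
have [[v0 v0r]|r0] := pselect (exists v0, v0 \in r); last first.
  exists (fun=> 0) => u x y _ vx _ _ _ tx.
  by case: r0; exists x; apply/rP.
have [v /max_onP[/rP[vv tv] hv]] := exists_max_on (fun y => - dot h y) v0r.
have [a aP] : exists a, primitive_above h (dot h v) a.
  apply: IHN; apply: leq_trans leN.
  rewrite -size_filter -[X in (_ < X)%N]size_filter -/r.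
  have -> : [seq y <- vtxs | dot h v < dot h y] = [seq y <- r | dot h v < dot h y].
    rewrite /r -filter_predI; apply: eq_filter => y /=.
    by case: (boolP (dot h v < dot h y)) => //= /(lt_trans tv) ->.
  rewrite size_filter -(count_predC (fun y => dot h v < dot h y) r).
  rewrite -addn1 leq_add2l -has_count; apply/hasP; exists v; first exact/rP.
  by rewrite /= ltxx.
have cvv u x : u != 0 -> vtx x -> mx u x -> c x x = 0.
  by move=> u0 vx ux; apply: (@addrI _ (c x x)); rewrite addr0 (@cD u).
have split y : vtx y -> t < dot h y -> y = v \/ dot h v < dot h y.
  move=> vy ty; have : dot h v <= dot h y by rewrite -lerN2 hv //; apply/rP.
  rewrite le_eqVlt => /predU1P[/hi->|]; [|exact: vtx_mem|exact: vtx_mem|]; by [left|right].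
pose up u x := [/\ u != 0, vtx x, mx u v, mx u x & dot h v < dot h x].
(* The value at the new vertex [v], set to [0] if no higher vertex is cofacial with [v]. *)
have [b bP] : exists b, forall u x, up u x -> c v x = b - a x.
  have [[u [x [u0 vx uv ux hx]]]|none] := pselect (exists u x, up u x).
    exists (c v x + a x) => u' x' [u'0 vx' u'v u'x' hx'].
    by rewrite (@step_const h v a u u' x x') // addrK.
  by exists 0 => u x ux; case: none; exists u, x.
exists (fun y => if y == v then b else a y) => u x y u0 vx vy ux uy tx ty.
have neqv z : dot h v < dot h z -> (z == v) = false.
  by apply: contraTF => /eqP ->; rewrite ltxx.
case: (split x vx tx) => [ex|hx]; case: (split y vy ty) => [ey|hy].
- by subst x y; rewrite subrr (cvv u).
- by subst x; rewrite eqxx neqv // (bP u).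
- subst y; rewrite eqxx neqv //; apply: (@addrI _ (c v x)).
  rewrite (@cD u) // (cvv u) // (bP u) //.
  by rewrite addrC addrA subrK subrr.
- by rewrite !neqv // (aP u).
Qed.

End Exactness.

Definition anti x y := exists u, [/\ u != 0, mx u x & mx (- u) y].

Lemma anti_sym x y : anti x y -> anti y x.
Proof. by move=> [u [u0 ux uy]]; exists (- u); rewrite oppr_eq0 opprK. Qed.

(** * Splitting flat cochains into potentials *)

Section Splitting.
Variable phi : R3 R -> R3 R -> A.
Hypothesis phi_flat : forall u v v' w w', u != 0 -> is_edge s v v' ->
  is_edge s w w' -> mx u v -> mx u v' -> mx (- u) w -> mx (- u) w' ->
  phi v w - phi v' w = phi v w' - phi v' w'.

(** [face_edge_const] passes from edges to arbitrary vertices of the faces, once in each factor. *)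
Lemma face_flat u v v' w w' : u != 0 -> vtx v -> vtx v' -> vtx w -> vtx w' ->
  mx u v -> mx u v' -> mx (- u) w -> mx (- u) w' ->
  phi v w - phi v' w = phi v w' - phi v' w'.
Proof.
move=> u0 vv vv' vw vw' uv uv' uw uw'.
apply: (@face_edge_const _ _ full _ (fun y => phi v y - phi v' y) (- u)) => //.
  by rewrite oppr_eq0.
move=> y y' eyy' uy uy'.
apply: subr_exchange.
apply: (@face_edge_const _ _ full _ (fun x => phi x y - phi x y') u) => //.
move=> x x' exx' ux ux'.
exact: subr_exchange (phi_flat u0 exx' eyy' ux ux' uy uy').
Qed.

(** Directions maximal at both [v] and [x] form a convex cone, and [face_flat] applies along its
    segment from [u] to [u']. *)
Lemma cofacial_diff u u' v x w w' : u != 0 -> u' != 0 ->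
  vtx v -> vtx x -> vtx w -> vtx w' -> mx u v -> mx u x -> mx u' v -> mx u' x ->
  mx (- u) w -> mx (- u') w' -> phi v w - phi x w = phi v w' - phi x w'.
Proof.
move=> u0 u'0 vv vx vw vw' uv ux u'v u'x uw u'w'.
apply: (@segment_const _ _ full _ (fun y => phi v y - phi x y) (- u) (- u')) => //.
  move=> tau tau0 y z vy vz; rewrite scalerN -opprD => my mz.
  apply: (@face_flat (u + tau *: u')) => //; last 2 first.
  - exact: mx_segment.
  - exact: mx_segment.
  exact: mx_segment_neq0 uv u'v.
by move=> y z vy vz my mz; apply: (@face_flat u').
Qed.

Lemma phi_split : exists a b, forall v w, vtx v -> vtx w -> anti v w ->
  phi v w = a v + b w.
Proof.
(* By [cofacial_diff] the choice of [w] is immaterial; the default [0] only occurs when [v] and [x]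
   share no proper face. *)
pose c v x := xget 0 [set d | exists u w, [/\ u != 0, mx u v, mx u x,
  vtx w & mx (- u) w /\ d = phi v w - phi x w]]%classic.
have cE u v x w : u != 0 -> vtx v -> vtx x -> vtx w -> mx u v -> mx u x ->
    mx (- u) w -> c v x = phi v w - phi x w.
  move=> u0 vv vx vw uv ux uw; rewrite /c; case: xgetP => [d _|/(_ (phi v w - phi x w))].
    move=> [u' [w' [u'0 u'v u'x vw' [u'w' ->]]]].
    exact: (@cofacial_diff u' u).
  by case; exists u, w.
have [a aP] : exists a, forall u x y, u != 0 -> vtx x -> vtx y ->
    mx u x -> mx u y -> c x y = a x - a y.
  apply: cocycle_exact => u x y z u0 vx vy vz ux uy uz.
  have [w vw uw] := exists_vtx full (- u).
  by rewrite !(cE u _ _ w) // subrKA.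
exists a, (fun w => xget 0 [set d | exists v, [/\ vtx v, anti v w & d = phi v w - a
  v]]%classic).
move=> v w vv vw vwa; case: xgetP => [d _|/(_ (phi v w - a v))]; last first.
  by case; exists v.
move=> [v' [vv' [u' [u'0 u'v' u'w]] ->]]; apply/eqP; rewrite addrC -subr_eq.
have [u [u0 uv uw]] := vwa; apply/eqP.
have key n x y : n != 0 -> vtx x -> vtx y -> mx n x -> mx n y -> mx (- n) w ->
    phi x w - a x = phi y w - a y.
  move=> n0 vx vy nx ny nw; have := cE n x y w n0 vx vy vw nx ny nw.
  by rewrite (aP n) // => /esym /subr_exchange.
(* The directions whose negative is maximal at [w] form a convex cone, so the antipodes of [w] are
   compared along a segment inside it. *)
apply: (@segment_const _ _ full _ (fun y => phi y w - a y) u u') => //.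
  move=> tau tau0 x y vx vy dx dy; apply: (key (u + tau *: u')) => //.
    rewrite -[u']opprK scalerN -[u]opprK -opprD oppr_eq0.
    by apply: mx_segment_neq0 uw u'w => //; rewrite oppr_eq0.
  by rewrite opprD -scalerN; apply: mx_segment.
by move=> x y vx vy dx dy; apply: (key u').
Qed.

End Splitting.

(* On the antipodal graph itself the potentials of both sides are related, and
   the relation leaves the 2-torsion that detects the parity of a walk. *)
Lemma antisym_split (phi : R3 R -> R3 R -> A) :
  (forall v w, phi w v = - phi v w) ->
  (forall v v' w w', is_edge s v v' -> is_edge s w w' -> 
     (exists u, [/\ u != 0, mx u v, mx u v', mx (- u) w & mx (- u) w']) ->
     phi v w + phi w v' + phi v' w' + phi w' v = 0) ->
  exists a tau, tau + tau = 0 /\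
    forall v w, vtx v -> vtx w -> anti v w -> phi v w = a v - a w + tau.
Proof.
move=> phiN flat.
have [u v v' w w' u0 ev ew uv uv' uw uw'|a [b abP]] := @phi_split phi.
  have /eqP := flat v v' w w' ev ew (ex_intro _ u (And5 u0 uv uv' uw uw')).
  rewrite (phiN v' w) (phiN v w') -addrA -(opprB (phi v w') (phi v' w')) subr_eq0.
  by move=> /eqP.
have abN v w : vtx v -> vtx w -> anti v w -> a w + b w = - (a v + b v).
  move=> vv vw vwa; have := phiN v w; rewrite (abP v w) // (abP w v) //; last first.
    exact: anti_sym.
  move=> e; apply/eqP; rewrite -subr_eq0 opprK.
  by rewrite (addrC (a v)) addrACA e (addrC (b w)) addNr.
have [v0 vv0 m0] := exists_vtx full (const_mx 1).
have tauE v : vtx v -> a v + b v = a v0 + b v0.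
  move=> vv; apply: (@cofacial_const _ _ full _ (fun v => a v + b v)) => //.
  move=> u x y u0 vx vy ux uy; have [w vw uw] := exists_vtx full (- u).
  by apply: oppr_inj; rewrite -!(@abN _ w) //; exists u.
exists a, (a v0 + b v0); split.
  have [w vw uw] := exists_vtx full (- const_mx 1).
  have c0 : const_mx 1 != 0 :> R3 R.
    by apply/eqP => /rowP/(_ 0)/eqP; rewrite !mxE oner_eq0.
  rewrite -{1}(tauE w vw) (@abN v0 w) ?addNr //; by exists (const_mx 1).
move=> v w vv vw vwa; rewrite -(tauE w vw) (abP v w) //.
by rewrite addrA subrK.
Qed.

End Cocycles.

(** * Faces of a polytope given by its points *)

Section Hull.
Variable R : realType.
Implicit Types u v w x y z : R3 R.
Implicit Type s : seq (R3 R).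

Local Open Scope classical_set_scope.

Lemma sub_convex_hull (S : set (R3 R)) x : S x -> convex_hull S x.
Proof.
move=> Sx; exists 1%N, (fun=> 1), (fun=> x).
by split; rewrite ?big_ord1 ?scale1r.
Qed.

Lemma convex_hull_mono (S T : set (R3 R)) :
  S `<=` T -> convex_hull S `<=` convex_hull T.
Proof.
by move=> ST x [n [t [p [Sp t0 t1 ->]]]]; exists n, t, p; split=> // i; apply: ST.
Qed.

Lemma dot_convex_hull_le (S : set (R3 R)) u b :
  (forall x, S x -> dot u x <= b) -> forall z, convex_hull S z -> dot u z <= b.
Proof.
move=> Sb z [n [t [p [Sp t0 t1 ->]]]].
rewrite dot_sumr -[b]mul1r -t1 mulr_suml.
by apply: ler_sum => i _; rewrite ler_wpM2l // Sb.
Qed.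

(** The nonnegative terms [t i * (b - dot u (p i))] sum to zero. *)
Lemma convex_hull_active (S : set (R3 R)) u b n (t : 'I_n -> R) p :
  (forall i, S (p i)) -> (forall i, 0 <= t i) -> \sum_i t i = 1 ->
  (forall x, S x -> dot u x <= b) -> dot u (\sum_i t i *: p i) = b ->
  forall i, t i != 0 -> dot u (p i) = b.
Proof.
move=> Sp t0 t1 Sb eb i ti.
have /psumr_eq0P H : \sum_i t i * (b - dot u (p i)) = 0.
  under eq_bigr do rewrite mulrBr.
  by rewrite sumrB -mulr_suml t1 mul1r -dot_sumr eb subrr.
have /eqP : t i * (b - dot u (p i)) = 0.
  by apply: H => // j _; rewrite mulr_ge0 // subr_ge0 Sb.
by rewrite mulf_eq0 (negPf ti) subr_eq0 => /eqP ->.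
Qed.

Lemma sum_segment v w n (t : 'I_n -> R) (p : 'I_n -> R3 R) :
  (forall i, 0 <= t i) -> \sum_i t i = 1 ->
  (forall i, t i != 0 -> exists2 l, 0 <= l <= 1 & p i = v + l *: (w - v)) ->
  exists2 l, 0 <= l <= 1 & \sum_i t i *: p i = v + l *: (w - v).
Proof.
move=> t0 t1 pP.
have /choice[l lP] i : exists l, 0 <= l <= 1 /\ t i *: p i = t i *: (v + l *: (w - v)).
  have [->|/pP[l l01 ->]] := eqVneq (t i) 0; last by exists l.
  by exists 0; rewrite !scale0r lexx ler01.
exists (\sum_i t i * l i).
  apply/andP; split.
    by apply: sumr_ge0 => i _; rewrite mulr_ge0 //; case: (lP i) => /andP[].
  by rewrite -t1 ler_sum // => i _; rewrite ler_piMr //; case: (lP i) => /andP[].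
transitivity (\sum_i (t i *: v + (t i * l i) *: (w - v))).
  by apply: eq_bigr => i _; rewrite (lP i).2 scalerDr scalerA.
by rewrite big_split /= -!scaler_suml t1 scale1r.
Qed.

Lemma convex_hull2P v w z : convex_hull [set v; w] z <->
  exists2 l, 0 <= l <= 1 & z = v + l *: (w - v).
Proof.
split=> [[n [t [p [Sp t0 t1 ->]]]]|[l /andP[l0 l1] ->]].
  apply: sum_segment => // i _; case: (Sp i) => ->.
    by exists 0; rewrite ?lexx ?ler01 // scale0r addr0.
  by exists 1; rewrite ?lexx ?ler01 // scale1r addrC subrK.
exists 2%N, (fun i => if i == 0 then 1 - l else l), (fun i => if i == 0 then v else w).
rewrite !big_ord_recl !big_ord0 /= !addr0; split.
- by move=> i; case: ifP; [left|right].
- by move=> i; case: ifP => // _; rewrite subr_ge0.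
- by rewrite subrK.
- by rewrite scalerBl scale1r scalerBr addrA addrAC.
Qed.

Lemma convex_hull2C v w : convex_hull [set v; w] = convex_hull [set w; v].
Proof. by rewrite setUC. Qed.

Lemma finite_fset2 (T : choiceType) (A : set T) (B : set {fset T}) :
  finite_set A -> (forall b, B b -> exists p q, [/\ A p, A q & b = [fset p; q]%fset]) ->
  finite_set B.
Proof.
move=> fA Bsub; apply: (@sub_finite_set _ _ ((fun p => [fset p.1; p.2]%fset) @` (A `*` A))).
  by move=> b /Bsub[p [q [Ap Aq ->]]]; exists (p, q).
by apply: finite_image; apply: finite_setX.
Qed.

(** * Vertices, edges and antipodality in terms of the generating points *)

Section Polytope.
Variables (s : seq (R3 R)) (P : set (R3 R)).
Hypothesis PE : P = convex_hull [set` s].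
Hypothesis dimP : full_dimensional P.

Local Notation mx := (mx s).
Local Notation vtx := (vtx s).

Lemma polytope_mem x : x \in s -> P x.
Proof. by move=> xs; rewrite PE; apply: sub_convex_hull. Qed.

(** A direction constant on [s] is constant on the affine hull, which contains both the direction
    itself and [0]. *)
Lemma polytope_full u : {in s &, forall x y, dot u x = dot u y} -> u = 0.
Proof.
move=> uc; case: (eqVneq s [::]) => [s0|]; last first.
  case Es : s => [//|x0 r] _; have x0s : x0 \in s by rewrite Es mem_head.
  have uP x : P x -> dot u x = dot u x0.
    rewrite PE => xP; apply/le_anti/andP; split.
      by apply: dot_convex_hull_le xP => y ys; rewrite (uc y x0).
    rewrite -lerN2 -!dotNl; apply: dot_convex_hull_le xP => y ys.
    by rewrite !dotNl (uc y x0).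
  have uA x : dot u x = dot u x0.
    have : affine_hull P x by rewrite dimP.
    move=> [n [t [p [Pp t1 ->]]]]; rewrite dot_sumr -[RHS]mul1r -t1 mulr_suml.
    by apply: eq_bigr => i _; rewrite (uP (p i)).
  by apply/eqP; rewrite -dotuu_eq0 uA -(uA 0) dot0r.
have : affine_hull P 0 by rewrite dimP.
move=> [[|n] [t [p [Pp t1 _]]]].
  by move: t1; rewrite big_ord0 => /eqP; rewrite eq_sym oner_eq0.
have := Pp 0; rewrite PE => -[[|k] [t' [p' [sp' _ t1' _]]]].
  by move: t1'; rewrite big_ord0 => /eqP; rewrite eq_sym oner_eq0.
by have := sp' 0; rewrite /= s0.
Qed.

Lemma mx_polytope_le u x z : mx u x -> P z -> dot u z <= dot u x.
Proof.
by move=> ux; rewrite PE; apply: dot_convex_hull_le => y; apply: mx_le.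
Qed.

Lemma mx_of_polytope u x : x \in s -> (forall z, P z -> dot u z <= dot u x) ->
  mx u x.
Proof.
by move=> xs ux; apply/max_onP; split=> // y /polytope_mem; apply: ux.
Qed.

Lemma antipodalP x y : x \in s -> y \in s -> antipodal P x y <-> anti s x y.
Proof.
move=> xs ys; split=> [[_ _ [u u0 uxy]]|[u [u0 ux uy]]].
  exists u; split=> //; apply: mx_of_polytope => // z /uxy /andP[] //.
  by rewrite !dotNl lerN2.
split; [exact: polytope_mem|exact: polytope_mem|exists u => // z Pz].
by rewrite (mx_polytope_le ux) // andbT -lerN2 -!dotNl (mx_polytope_le uy).
Qed.

Lemma verticesP v : vertices P v <-> vtx v.
Proof.
split=> [[_ [u [c [u0 uc e]]]]|[k kv]].
  have [Pv uv] : P v /\ dot u v = c by have : [set v] v by []; rewrite e => -[].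
  have uniq x : x \in s -> dot u x = c -> x = v.
    move=> xs ux; have : (P `&` [set x | dot u x = c]) x.
      by split=> //; apply: polytope_mem.
    by rewrite -e.
  have [x ux] := exists_mx polytope_full u; have xs := mx_mem ux.
  have exv : x = v.
    apply: uniq => //; apply/le_anti; rewrite (uc _ (polytope_mem xs)) /= -uv.
    exact: mx_polytope_le ux Pv.
  exists u; split=> [|y ys yv]; first by rewrite -exv.
  rewrite uv lt_neqAle (uc _ (polytope_mem ys)) andbT.
  by apply: contra_neq yv => /uniq; apply.
have kx := exposes_mx kv.
split; first by exists v.
exists k, (dot k v); split; first exact (exposes_neq0 polytope_full kv).
  by move=> x; apply: mx_polytope_le.
apply/seteqP; split=> [x ->|x [Px ex]]; first by split=> //; apply/polytope_mem/(mx_mem kx).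
move: Px; rewrite PE => -[n [t [p [sp t0 t1 ex']]]].
have act := @convex_hull_active [set` s] k (dot k v) n t p sp t0 t1.
rewrite ex' /= -[v]scale1r -t1 scaler_suml; apply: eq_bigr => i _.
have [->|ti] := eqVneq (t i) 0; first by rewrite !scale0r.
congr (_ *: _); apply: (mx_exposes kv); apply: (mx_sub kx (sp i)).
by apply: act => // [y|]; [apply: mx_le|rewrite -ex'; exact: ex].
Qed.

(** Pushing [u] along [v - w] exposes a point of the segment, which can only be its end [v]. *)
Lemma face_segment_vtx u c v w : v != w -> u != 0 ->
  (forall x, P x -> dot u x <= c) ->
  convex_hull [set v; w] = P `&` [set x | dot u x = c] -> vtx v /\ mx u v.
Proof.
move=> vw u0 uc e; pose h := v - w.
have segP x : x \in s -> dot u x = c -> exists2 l, 0 <= l <= 1 & x = v + l *: (w - v).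
  by move=> xs ux; apply/convex_hull2P; rewrite e; split=> //; apply: polytope_mem.
have [Pv uv] : P v /\ dot u v = c.
  have : convex_hull [set v; w] v by apply: sub_convex_hull; left.
  by rewrite e => -[].
have [eps eps0 epsP] := exists_perturb s u h.
have [y vy ky] := exists_vtx polytope_full (u + eps *: h).
have [uy hy] := (epsP y).1 ky; have ys := mx_mem uy.
have uyc : dot u y = c.
  apply/le_anti; rewrite (uc _ (polytope_mem ys)) /= -uv; exact: mx_polytope_le uy Pv.
have [l /andP[l0 l1] ey] := segP y ys uyc.
have : dot (u + eps *: h) v <= dot (u + eps *: h) y by apply: mx_polytope_le ky Pv.
rewrite !dotDl uv uyc lerD2l !dotZl ler_pM2l //.
have -> : dot h y = dot h v - l * dot h h.
  by rewrite ey dotDr dotZr -[w - v]opprB -/h -scaleN1r dotZr; ring.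
have hh : 0 < dot h h by rewrite dotuu_gt0 // subr_eq0.
move=> le; have l00 : l = 0 by nra.
by rewrite l00 scale0r addr0 in ey; rewrite -ey.
Qed.

Lemma edgesP e : edges P e <-> exists x y, is_edge s x y /\ e = [fset x; y]%fset.
Proof.
split=> [[v [w [vw [_ [u [c [u0 uc f]]]] ->]]]|[x [y [[xy vx vy [w [w0 wx wy wz]]] ->]]]].
  exists v, w; split=> //.
  have [vv uv] := face_segment_vtx vw u0 uc f.
  have [vw' uw] : vtx w /\ mx u w.
    by apply: (@face_segment_vtx u c w v) => //; rewrite 1?eq_sym // convex_hull2C.
  split=> //; exists u; split=> // z uz; apply/convex_hull2P; rewrite f.
  split; first exact/polytope_mem/(mx_mem uz).
  rewrite /= (mx_eq uz uv); have : convex_hull [set v; w] v by apply: sub_convex_hull; left.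
  by rewrite f => -[].
exists x, y; split=> //; split; first by exists x; apply: sub_convex_hull; left.
exists w, (dot w x); split=> //; first by move=> z; apply: mx_polytope_le.
apply/seteqP; split=> [z hz|z [Pz ez]].
  split; first by rewrite PE; apply: convex_hull_mono hz => t [->|->]; apply: mx_mem;
    eassumption.
  have [l _ ->] := (convex_hull2P _ _ _).1 hz.
  by rewrite /= dotDr dotZr dotBr (mx_eq wy wx) subrr mulr0 addr0.
move: Pz; rewrite PE => -[n [t [p [sp t0 t1 ez']]]].
have act := @convex_hull_active [set` s] w (dot w x) n t p sp t0 t1.
apply/convex_hull2P; rewrite ez'; apply: sum_segment => // i ti.
apply: wz; apply: (mx_sub wx (sp i)).
by apply: act => // [q|]; [apply: mx_le|rewrite -ez'; exact: ez].
Qed.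

Lemma midpoint2 x y : x != y -> midpoint [fset x; y]%fset = 2^-1 *: (x + y).
Proof.
move=> xy; rewrite /midpoint big_fsetU1 /= ?inE // big_seq_fset1 //.
Qed.

(** The value at a midpoint is the average of the values at the ends, so it is extremal only if both
    ends are. *)
Lemma antipodal_midpointP x y z w : is_edge s x y -> is_edge s z w ->
  antipodal P (midpoint [fset x; y]%fset) (midpoint [fset z; w]%fset) <->
  exists u, [/\ u != 0, mx u x, mx u y, mx (- u) z & mx (- u) w].
Proof.
move=> [xy vx vy _] [zw vz vw _]; rewrite !midpoint2 //.
have [xs ys zs ws] := And4 (vtx_mem vx) (vtx_mem vy) (vtx_mem vz) (vtx_mem vw).
have mid_mem a b : a \in s -> b \in s -> P (2^-1 *: (a + b)).
  move=> sa sb; rewrite PE; apply: (@convex_hull_mono [set a; b]).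
    by move=> c [->|->].
  apply/convex_hull2P; exists 2^-1; first lra.
  by apply: R3P; rewrite !mxE; field.
split=> [[_ _ [u u0 H]]|[u [u0 ux uy uz uw]]].
  have hm := H _ (polytope_mem _); move: (hm x xs) (hm y ys) (hm z zs) (hm w ws).
  rewrite !dotZr !dotDr => /andP[x1 x2] /andP[y1 y2] /andP[z1 z2] /andP[w1 w2].
  exists u; split=> //; apply: mx_of_polytope => // q /H;
    by rewrite ?dotNl !dotZr !dotDr => /andP[]; lra.
split; [exact: mid_mem|exact: mid_mem|exists u => // q Pq].
have := mx_polytope_le ux Pq; have := mx_polytope_le uy Pq.
have := mx_polytope_le uz Pq; have := mx_polytope_le uw Pq.
by rewrite !dotNl !dotZr !dotDr => *; apply/andP; split; lra.
Qed.

Lemma finite_vertices : finite_set (vertices P).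
Proof.
apply: (@sub_finite_set _ _ [set` s]); last exact: finite_seq.
by move=> v /verticesP/vtx_mem.
Qed.

Lemma finite_antipodal_pairs : finite_set (antipodal_pairs P).
Proof.
by apply: finite_fset2 finite_vertices _ => a [v [w [vv vw _ _ ->]]]; exists v, w.
Qed.

Lemma finite_edges : finite_set (edges P).
Proof.
apply: finite_fset2 finite_vertices _ => e /edgesP[x [y [[_ vx vy _] ->]]].
by exists x, y; split=> //; apply/verticesP.
Qed.

Lemma finite_antipodal_squares : finite_set (antipodal_squares P).
Proof.
by apply: finite_fset2 finite_edges _ => q [e [f [ee ef _ _ ->]]]; exists e, f.
Qed.

End Polytope.
End Hull.

(** * Integer matrices whose cokernel is free plus Z/2 *)

Section KernelCokernel.
Variables (m n : nat) (D : 'M[int]_(m, n)).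
Local Open Scope quotient_scope.

Definition coker_pi (x : 'cV[int]_m) : coker D := \pi_(Quotient.quot (im_pred D)) x.

Lemma coker_piB x y : coker_pi (x - y) = coker_pi x - coker_pi y.
Proof. by rewrite /coker_pi raddfB. Qed.

HB.instance Definition _ :=
  GRing.isZmodMorphism.Build 'cV[int]_m (coker D) coker_pi coker_piB.

Lemma coker_pi_eq0 x : coker_pi x = 0 <-> exists y, x = D *m y.
Proof.
have -> : (coker_pi x = 0) <-> x \in im_pred D.
  rewrite -[x in x \in _]subr0 Quotient.idealrBE.
  by split=> [e|/eqP e]; [apply/eqP|]; move: e; rewrite -/(coker_pi _) -/(coker_pi 0) raddf0.
by rewrite unfold_in; split=> /asboolP.
Qed.

Lemma zmod_isomorphicI (U V : zmodType) (f : {additive U -> V}) :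
  (forall x, f x = 0 -> x = 0) -> (forall y, exists x, f x = y) ->
  zmod_isomorphic U V.
Proof.
move=> f0 /choice[g gK]; exists f; exists g => // x.
by apply/eqP; rewrite -subr_eq0; apply/eqP/f0; rewrite raddfB gK subrr.
Qed.

(** The first isomorphism theorem. *)
Lemma coker_isomorphic (V : zmodType) (f : {additive 'cV[int]_m -> V}) :
  (forall y, exists x, f x = y) -> (forall x, f x = 0 <-> exists y, x = D *m y) ->
  zmod_isomorphic (coker D) V.
Proof.
move=> fsurj fker; pose g (c : coker D) := f (repr (c : Quotient.quot _)).
have gpi x : g (coker_pi x) = f x.
  apply/eqP; rewrite -subr_eq0 -raddfB; apply/eqP/fker/coker_pi_eq0.
  by rewrite coker_piB {1}/coker_pi reprK subrr.
have piP (c : coker D) : exists x, c = coker_pi x.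
  by exists (repr (c : Quotient.quot _)); rewrite /coker_pi reprK.
have gB : zmod_morphism g.
  by move=> a b; case: (piP a) => x ->; case: (piP b) => y ->; rewrite -coker_piB !gpi raddfB.
pose G : {additive coker D -> V} := HB.pack g (GRing.isZmodMorphism.Build _ _ g gB).
apply: (@zmod_isomorphicI _ _ G) => [c|y].
  by case: (piP c) => x ->; rewrite [G _]gpi fker => /coker_pi_eq0.
by have [x <-] := fsurj y; exists (coker_pi x); exact: gpi.
Qed.

End KernelCokernel.

Definition diagonal_mx m n (d : seq int) : 'M[int]_(m, n) :=
  \matrix_(i, j) (d`_i *+ (i == j :> nat)).

Lemma diagonal_mulE m n (d : seq int) (x : 'cV[int]_n) (i : 'I_m) :
  (diagonal_mx m n d *m x) i 0 = if insub (i : nat) is Some j then d`_i * x j 0 else 0.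
Proof.
rewrite mxE; case: insubP => [j ltin ej|nlt].
  rewrite (bigD1 j) //= mxE ej eqxx mulr1n big1 ?addr0 // => k kj.
  by rewrite mxE -ej (_ : (j == k :> nat) = false) ?mulr0n ?mul0r // eq_sym; exact: negbTE.
rewrite big1 // => k _; rewrite mxE (_ : (i == k :> nat) = false) ?mulr0n ?mul0r //.
by apply: contraNF nlt => /eqP ->.
Qed.

(* The columns missing when [n < m] count as zero diagonal entries. *)
Definition diagonal_entry n (d : seq int) i := if (i < n)%N then d`_i else 0.

Lemma diagonal_imageP m n d (x : 'cV[int]_m) :
  (exists y, x = diagonal_mx m n d *m y) <->
  forall i, (diagonal_entry n d i %| (x i 0)%R)%Z.
Proof.
rewrite /diagonal_entry; split=> [[y ->] i|H].
  rewrite diagonal_mulE; case: insubP => [j ltin ej|/negPf->] //.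
  by rewrite ltin dvdz_mulr.
have /choice[q qP] i : exists q, x i 0 = diagonal_entry n d i * q.
  by have /dvdzP[q ->] := H i; exists q; rewrite mulrC.
exists (\col_j (if insub (j : nat) is Some i then q i else 0)); apply/colP => i.
rewrite diagonal_mulE qP /diagonal_entry; case: insubP => [j ltin ej|/negPf ->].
  rewrite ltin !mxE ej; congr (_ * _); case: insubP => [i' _ ei|]; last by rewrite ltn_ord.
  by congr q; apply: val_inj.
by rewrite mul0r.
Qed.

(** * Diagonal matrices whose image is the even part of the kernel of [bd] *)

Section DiagonalParity.
Variables (m n k : nat) (d : seq int) (bd : 'M[int]_(k, m)) (par : 'rV[int]_m).
Hypothesis d_sorted : sorted dvdz d.
Let Delta := diagonal_mx m n d.
Hypothesis bd0 : bd *m Delta = 0.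
Hypothesis par_even : forall x : 'cV_n, (2 %| ((par *m (Delta *m x)) 0 0)%R)%Z.
Hypothesis exactD : forall x : 'cV_m, bd *m x = 0 -> (2 %| ((par *m x) 0 0)%R)%Z ->
  exists y, x = Delta *m y.
Variable S : 'M[int]_(m, k).
Hypothesis bdS : bd *m S = 1%:M.
Variable x0 : 'cV[int]_m.
Hypothesis bdx0 : bd *m x0 = 0.
Hypothesis parx0 : ~~ (2 %| ((par *m x0) 0 0)%R)%Z.

Local Notation e_ i := (delta_mx i 0 : 'cV[int]_m).

Let dd i := diagonal_entry n d i.

Lemma diagonal_entry_dvd i j : (i <= j)%N -> (dd i %| dd j)%Z.
Proof.
rewrite /dd /diagonal_entry; case: (ltnP j n) => [jn ij|_ _]; last exact: dvdz0.
rewrite (leq_ltn_trans ij jn).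
have [jd|jd] := ltnP j (size d); last by rewrite (nth_default _ jd).
by apply: (sorted_leq_nth (@dvdz_trans) dvdzz) => //; rewrite inE // (leq_ltn_trans ij).
Qed.

Lemma mul_delta_col (p : nat) (B : 'M[int]_(p, m)) (i : 'I_m) j :
  (B *m (e_ i)) j 0 = B j i.
Proof. by rewrite -colE mxE. Qed.

Lemma exact_dvd (x : 'cV_m) : bd *m x = 0 -> (2 %| ((par *m x) 0 0)%R)%Z ->
  forall i : 'I_m, (dd i %| (x i 0)%R)%Z.
Proof. by move=> bx px; apply/diagonal_imageP/exactD. Qed.

(** Twice a cycle is an even cycle. *)
Lemma exact_dvd2 (x : 'cV_m) : bd *m x = 0 -> forall i : 'I_m, (dd i %| (2 * x i 0)%R)%Z.
Proof.
move=> bx i; have -> : 2 * x i 0 = (2 *: x) i 0 by rewrite mxE.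
by apply: exact_dvd; rewrite -scalemxAr ?bx ?scaler0 // mxE dvdz_mulr.
Qed.

Lemma dd_scaled_image (i : 'I_m) : exists y, dd i *: (e_ i) = Delta *m y.
Proof.
apply/diagonal_imageP => j; rewrite !mxE eqxx andbT.
by case: eqVneq => [->|_]; rewrite ?mulr1 ?mulr0 ?dvdzz ?dvdz0.
Qed.

Lemma torsion_col0 (i : 'I_m) j : dd i != 0 -> bd j i = 0.
Proof.
move=> di; have [y ey] := dd_scaled_image i.
have /colP/(_ j) : bd *m (dd i *: (e_ i)) = 0 by rewrite ey mulmxA bd0 mul0mx.
rewrite -scalemxAr mxE mul_delta_col mxE => /eqP.
by rewrite mulf_eq0 (negPf di) => /eqP.
Qed.

Lemma torsion_delta (i : 'I_m) : dd i != 0 -> bd *m (e_ i) = 0.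
Proof. by move=> di; apply/colP => j; rewrite mul_delta_col torsion_col0 // mxE. Qed.

Lemma exact_free0 (x : 'cV_m) (i : 'I_m) : bd *m x = 0 -> dd i = 0 -> x i 0 = 0.
Proof.
move=> bx di; have := exact_dvd2 bx i.
by rewrite di dvd0z mulf_eq0 => /eqP.
Qed.

(** These indices carry the factor Z/2: exactly one exists, and its diagonal entry is 2 up to
    sign. *)
Definition odd_par (i : 'I_m) := (dd i != 0) && ~~ (2 %| (par 0 i)%R)%Z.

(** The odd cycle [x0] is supported on nonzero diagonal entries, one of which must then have odd
    parity. *)
Lemma exists_odd_par : exists i, odd_par i.
Proof.
apply: contrapT => none; move/negP: parx0; apply; rewrite mxE.
apply: rpred_sum => i _.
have [di|di] := eqVneq (dd i) 0; first by rewrite (exact_free0 bdx0 di) mulr0 dvdz0.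
rewrite dvdz_mulr //; apply: contrapT => /negP pi; apply: none; exists i.
by rewrite /odd_par di.
Qed.

Lemma odd_par_dvd i : odd_par i -> (2 %| dd i)%Z /\ (dd i %| 2)%Z.
Proof.
move=> /andP[di pi]; split.
  have [y ey] := dd_scaled_image i; have := par_even y.
  rewrite -ey -scalemxAr mxE mul_delta_col.
  rewrite !dvdzE abszM Euclid_dvdM // => /orP[//|]; by move: pi; rewrite dvdzE => /negPf ->.
by have := exact_dvd2 (torsion_delta di) i; rewrite !mxE !eqxx mulr1.
Qed.

Lemma even_par_dvd (i : 'I_m) : dd i != 0 -> ~~ odd_par i -> (dd i %| 1)%Z.
Proof.
move=> di; rewrite /odd_par di negbK /= => pi.
have := exact_dvd (torsion_delta di); rewrite mul_delta_col => /(_ pi i).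
by rewrite !mxE !eqxx.
Qed.

(** For [i != j], the sum of both basis vectors would be an even cycle with a coordinate 1, which
    the even entry [dd i] would have to divide. *)
Lemma odd_par_uniq i j : odd_par i -> odd_par j -> i = j.
Proof.
move=> oi oj; apply: contrapT => /eqP ij.
have /andP[di pi] := oi; have /andP[dj pj] := oj.
have := @exact_dvd ((e_ i) + (e_ j)).
rewrite mulmxDr !torsion_delta // addr0 mulmxDr mxE !mul_delta_col => /(_ erefl).
have -> : (2 %| (par 0 i + par 0 j)%R)%Z by move: pi pj; lia.
move=> /(_ isT i); rewrite !mxE !eqxx (negPf ij) addr0 => d1.
by have := dvdz_trans (odd_par_dvd oi).1 d1.
Qed.

(** All nonzero entries other than the one of odd parity are units; the divisibility chain forces
    them before it and leaves only zeros after it. *)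
Lemma diagonal_shape : exists i0 : 'I_m,
  [/\ (i0 < n)%N, `|dd i0|%N = 2%N, forall i, (i < i0)%N -> `|dd i|%N = 1%N
    & forall i, (i0 < i < m)%N -> dd i = 0].
Proof.
have [i0 o0] := exists_odd_par; exists i0; have /andP[d0 _] := o0.
have [d2 d2'] := odd_par_dvd o0.
have unit_dvd (i : 'I_m) : i != i0 -> dd i != 0 -> (dd i %| 1)%Z.
  move=> ii di; apply: even_par_dvd di _.
  by apply: contra_neqN ii => oi; apply: odd_par_uniq.
split.
- by move: d0; rewrite /dd /diagonal_entry; case: ifP; rewrite ?eqxx.
- by apply/eqP; rewrite eqn_dvd; apply/andP; split; [move: d2'|move: d2]; rewrite dvdzE.
- move=> i ii; have im := ltn_trans ii (ltn_ord i0).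
  apply/eqP; rewrite -dvdz1; apply: (unit_dvd (Ordinal im)).
    by rewrite -val_eqE /= ltn_eqF.
  apply: contraNneq d0 => di.
  by rewrite -dvd0z -di diagonal_entry_dvd // ltnW.
- move=> i /andP[ii im]; apply: contrapT => /eqP di.
  have := unit_dvd (Ordinal im); rewrite -val_eqE /= gtn_eqF // => /(_ isT di) d1.
  by have := dvdz_trans d2 (dvdz_trans (diagonal_entry_dvd (ltnW ii)) d1).
Qed.

(** [bd] vanishes on the first [r] coordinates, and restricted to the others by [J] it has the
    two-sided inverse [J^T *m S]. *)
Lemma diagonal_corank : forall r, (r <= m)%N ->
  (forall i, (i < r)%N -> dd i != 0) -> (forall i, (r <= i < m)%N -> dd i = 0) ->
  (m - r)%N = k.
Proof.
move=> r rm dr d0; pose J : 'M[int]_(m, m - r) := \matrix_(i, j) (i == r + j :> nat)%N%:R.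
have bdJE i (l : 'I_(m - r)) (j : 'I_m) : j = (r + l)%N :> nat -> (bd *m J) i l = bd i j.
  move=> ej; rewrite mxE (bigD1 j) //= mxE ej eqxx mulr1 big1 ?addr0 // => a aj.
  by rewrite mxE -ej (_ : (a == j :> nat) = false) ?mulr0 //; exact: negbTE.
have bdJ : bd *m J *m J^T = bd.
  apply/matrixP => i j; rewrite mxE.
  have [jr|rj] := ltnP j r.
    rewrite big1 ?torsion_col0 ?dr // => l _; rewrite [J^T _ _]mxE [J _ _]mxE.
    by rewrite ltn_eqF ?mulr0 // (leq_trans jr) // leq_addr.
  have jm : (j - r < m - r)%N by rewrite ltn_sub2r // (leq_ltn_trans rj).
  rewrite (bigD1 (Ordinal jm)) //= (bdJE _ _ j) /= ?subnKC //.
  rewrite [J^T _ _]mxE [J _ _]mxE /= subnKC // eqxx mulr1 big1 ?addr0 // => l lj.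
  rewrite [J^T _ _]mxE [J _ _]mxE (_ : (j == r + l :> nat)%N = false) ?mulr0 //.
  apply: contraNF lj => /eqP e; apply/eqP/val_inj => /=; by rewrite e addKn.
pose Z := bd *m J; pose T := J^T *m S.
have ZT : Z *m T = 1%:M by rewrite /Z /T mulmxA bdJ bdS.
have Zinj p (Y : 'M[int]_(m - r, p)) : Z *m Y = 0 -> Y = 0.
  move=> ZY; apply/matrixP => i j; rewrite [RHS]mxE.
  have ir : (r + i < m)%N by rewrite -ltn_subRL.
  have bJ : bd *m (J *m col j Y) = 0.
    by rewrite mulmxA -/Z -[col j Y]mulmx1 colE mulmx1 mulmxA ZY mul0mx.
  have := @exact_free0 _ (Ordinal ir) bJ; rewrite d0 /= ?leq_addr // => /(_ erefl).
  rewrite mxE (bigD1 i) //= !mxE /= eqxx mul1r big1 ?addr0 // => l li.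
  by rewrite !mxE /= eqn_add2l (_ : (i == l :> nat) = false) ?mul0r // eq_sym; exact: negbTE.
have TZ : T *m Z = 1%:M.
  by apply/eqP; rewrite -subr_eq0; apply/eqP/Zinj;
    rewrite mulmxBr mulmxA ZT mul1mx mulmx1 subrr.
by apply/anti_leq; rewrite (mulmx1_min ZT) (mulmx1_min TZ).
Qed.

Lemma diagonal_invariant_factors : exists r,
  [/\ (0 < r)%N, (r <= n)%N, (r + k)%N = m
    & exists2 E : 'M[int]_m, E \in unitmx &
        Delta = E *m diagonal_mx m n (rcons (nseq r.-1 1) 2)].
Proof.
have [i0 [i0n d0 dlt dgt]] := diagonal_shape.
exists i0.+1; split=> //.
  have <- := @diagonal_corank i0.+1; rewrite ?subnKC //; last 1 first.
    by move=> i; rewrite ltnS leq_eqVlt => /predU1P[->|/dlt di]; rewrite -absz_eq0 ?d0 ?di.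
(* Signs of the diagonal entries are moved into the invertible matrix [E]. *)
pose sg i : int := if d`_i < 0 then -1 else 1.
pose E : 'M[int]_m := diag_mx (\row_i sg i).
have EE : E *m E = 1%:M.
  rewrite /E mul_diag_mx; apply/matrixP => i j; rewrite !mxE /sg.
  by case: eqVneq => [->|_]; case: ifP; rewrite /= ?mulr1n ?mulr0n ?mulr0.
exists E; first by case: (mulmx1_unit EE).
rewrite /E mul_diag_mx; apply/matrixP => i j; rewrite !mxE.
have [eij|_] := eqVneq (i : nat) j; last by rewrite !mulr0n mulr0.
rewrite !mulr1n nth_rcons size_nseq /=.
have ein : dd i = d`_i by rewrite /dd /diagonal_entry eij ltn_ord.
have -> : d`_i = sg i * (absz d`_i)%:Z.
  by rewrite /sg; case: ltP => h; [rewrite ltz0_abs // mulN1r opprK|rewrite gez0_abs // mul1r].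
have [ilt|igt|e] := ltngtP i i0.
- by rewrite -ein dlt // nth_nseq ilt.
- by rewrite -ein dgt // igt ltn_ord.
- by rewrite -ein e d0.
Qed.

End DiagonalParity.

(** * Smith form, cokernel and kernel of a general parity-exact matrix *)

Section ParityExact.
Variables (m n k : nat) (D : 'M[int]_(m, n)) (bd : 'M[int]_(k, m)) (par : 'rV[int]_m).
Hypothesis bdD : bd *m D = 0.
Hypothesis par_even : forall x : 'cV_n, (2 %| ((par *m (D *m x)) 0 0)%R)%Z.
Hypothesis exactD : forall x : 'cV_m, bd *m x = 0 -> (2 %| ((par *m x) 0 0)%R)%Z ->
  exists y, x = D *m y.
Hypothesis bd_onto : exists S : 'M[int]_(m, k), bd *m S = 1%:M.
Hypothesis odd_cycle : exists2 x : 'cV[int]_m,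
  bd *m x = 0 & ~~ (2 %| ((par *m x) 0 0)%R)%Z.

Lemma parity_exact_smith : exists r,
  [/\ (0 < r)%N, (r <= n)%N, (r + k)%N = m
    & exists L N, [/\ L \in unitmx, N \in unitmx
        & D = L *m diagonal_mx m n (rcons (nseq r.-1 1) 2) *m N]].
Proof.
have [L Lu [N Nu [d dsort DE]]] := int_Smith_normal_form D.
rewrite -/(diagonal_mx m n d) in DE.
have [S bdS] := bd_onto; have [x0 bdx0 px0] := odd_cycle.
have DeltaE : L *m diagonal_mx m n d = D *m invmx N by rewrite DE mulmxK.
(* The base change [L] carries [bd] and [par] along and reduces to the diagonal case. *)
have [||x bx px||||r [r0 rn rk [E Eu DEE]]] := @diagonal_invariant_factors m n k d (bd *m L)
    (par *m L) dsort _ _ _ (invmx L *m S) _ (invmx L *m x0).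
- by rewrite -mulmxA DeltaE mulmxA bdD mul0mx.
- by move=> x; rewrite -mulmxA [L *m _]mulmxA DeltaE -mulmxA.
- have [||y ey] := @exactD (L *m x); rewrite ?mulmxA //.
  exists (N *m y); apply: (can_inj (mulKmx Lu)).
  by rewrite !mulmxA -DE.
- by rewrite -mulmxA mulKVmx.
- by rewrite -mulmxA mulKVmx.
- by rewrite -mulmxA mulKVmx.
exists r; split=> //; exists (L *m E), N.
by rewrite unitmx_mul Lu Eu Nu DE DEE mulmxA.
Qed.

Lemma parity_exact_coker :
  zmod_isomorphic (coker D) ('cV[int]_k * 'Z_2)%type.
Proof.
pose f (x : 'cV[int]_m) : 'cV[int]_k * 'Z_2 := (bd *m x, ((par *m x) 0 0)%:~R).
have fB : zmod_morphism f.
  by move=> x y; rewrite /f !mulmxBr; congr (_, _); rewrite !mxE mulrzBr.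
pose F : {additive 'cV[int]_m -> ('cV[int]_k * 'Z_2)%type} :=
  HB.pack f (GRing.isZmodMorphism.Build _ _ f fB).
have evenP (z : int) : (z%:~R = 0 :> 'Z_2) <-> (2 %| z)%Z.
  have natP p : (p%:R == 0 :> 'Z_2) = (2 %| p)%N by rewrite -val_eqE /= val_Zp_nat.
  have -> : (2 %| z)%Z = (z%:~R == 0 :> 'Z_2); last by split=> /eqP.
  by rewrite dvdzE; case: z => p; rewrite ?NegzE ?mulrNz ?oppr_eq0 -natP.
apply: (@coker_isomorphic _ _ D _ F) => [[y b]|x].
  have [S bdS] := bd_onto; have [x0 bdx0 px0] := odd_cycle.
  have y0 : bd *m (S *m y) = y by rewrite mulmxA bdS mul1mx.
  have [e|ne] := eqVneq ((par *m (S *m y)) 0 0)%:~R b.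
    by exists (S *m y); rewrite /F /= /f y0 e.
  (* Adding the odd cycle flips the parity and keeps the boundary. *)
  exists (S *m y + x0); rewrite /F /= /f mulmxDr y0 bdx0 addr0; congr (_, _).
  rewrite mulmxDr mxE mulrzDr.
  have : ((par *m x0) 0 0)%:~R != 0 :> 'Z_2 by apply: contra px0 => /eqP/evenP.
  move: ne; move: (_%:~R) (_%:~R) b => [[|[|//]] ?] [[|[|//]] ?] [[|[|//]] ?] //= *;
    exact: val_inj.
split=> [[bx /evenP px]|[y ->]]; first exact: exactD.
by rewrite /F /= /f mulmxA bdD mul0mx (evenP _).2.
Qed.

End ParityExact.

(** In the coordinates [N *m x] the kernel consists of the vectors whose first [r] entries
    vanish. *)
Lemma smith_ker_isomorphic m n (D : 'M[int]_(m, n)) L N r d : (r <= n)%N -> (r <= m)%N ->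
  L \in unitmx -> N \in unitmx -> size d = r -> all (fun c => c != 0) d ->
  D = L *m diagonal_mx m n d *m N -> zmod_isomorphic (ker D) 'cV[int]_(n - r).
Proof.
move=> rn rm Lu Nu sd d0 DE.
have kerP (x : 'cV_n) : D *m x = 0 <-> forall j : 'I_n, (j < r)%N -> (N *m x) j 0 = 0.
  have -> : D *m x = 0 <-> diagonal_mx m n d *m (N *m x) = 0.
    rewrite DE -!mulmxA; split=> [e|->]; last by rewrite mulmx0.
    by apply: (can_inj (mulKmx Lu)); rewrite e mulmx0.
  split=> [/colP H j jr|H].
    have := H (Ordinal (leq_trans jr rm)); rewrite diagonal_mulE mxE /=.
    case: insubP => [j' _ ej|]; last by rewrite ltn_ord.
    have -> : j' = j by apply: val_inj.
    move=> /eqP; rewrite mulf_eq0 => /orP[dj|/eqP//].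
    by have /allP/(_ d`_j) := d0; rewrite mem_nth ?sd // dj => /(_ isT).
  apply/colP => i; rewrite diagonal_mulE mxE; case: insubP => // j jn ej.
  have [jr|rj] := ltnP j r; first by rewrite H // mulr0.
  by rewrite nth_default ?mul0r // sd -ej.
have shift_lt (j : 'I_(n - r)) : (r + j < n)%N by rewrite -ltn_subRL.
pose f (x : ker D) : 'cV[int]_(n - r) := \col_j (N *m \val x) (Ordinal (shift_lt j)) 0.
have fB : zmod_morphism f.
  by move=> x y; apply/colP => j; rewrite !mxE -sumrB; apply: eq_bigr => i _;
    rewrite raddfB !mxE mulrBr.
pose F : {additive ker D -> 'cV[int]_(n - r)} :=
  HB.pack f (GRing.isZmodMorphism.Build _ _ f fB).
have valP' (x : ker D) : D *m \val x = 0.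
  by have := valP x; rewrite unfold_in => /eqP.
apply: (@zmod_isomorphicI _ _ F) => [x fx|y].
  apply: val_inj; rewrite /= ?raddf0; apply: (can_inj (mulKmx Nu)); rewrite mulmx0.
  apply/colP => j; rewrite [RHS]mxE; have [jr|rj] := ltnP j r.
    exact: (kerP (\val x)).1.
  have jn : (j - r < n - r)%N by rewrite ltn_sub2r // (leq_ltn_trans rj).
  have /colP/(_ (Ordinal jn)) : f x = 0 := fx; rewrite !mxE; apply: etrans.
  by apply: eq_bigr => i _; congr (N _ _ * _); apply: val_inj; rewrite /= subnKC.
(* For [j < r] the truncated [j - r] is [0]; the factor [(r <= j)] removes these entries. *)
pose z : 'cV[int]_n := \col_j (if insub (j - r)%N is Some i then y i 0 *+ (r <= j)%N else 0).
have zP : invmx N *m z \in ker_pred D.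
  rewrite unfold_in; apply/eqP/kerP => j jr; rewrite mulKVmx // mxE.
  by case: insubP => // i; rewrite [(r <= j)%N]leqNgt jr.
exists (Sub (invmx N *m z) zP); change (f (Sub (invmx N *m z) zP) = y).
apply/colP => j; rewrite mxE SubK mulKVmx // mxE /=.
case: insubP => [i _ ei|]; last by rewrite addKn ltn_ord.
by rewrite leq_addr; congr (y _ _); apply: val_inj; rewrite ei addKn.
Qed.

(** * The antipodal square complex *)

Lemma fset2_eq (T : choiceType) (a b c d : T) : [fset a; b]%fset = [fset c; d]%fset ->
  (a = c /\ b = d) \/ (a = d /\ b = c).
Proof.
move=> e; have /fset2P ha : a \in [fset c; d]%fset by rewrite -e fset21.
have /fset2P hb : b \in [fset c; d]%fset by rewrite -e fset22.
have /fset2P hc : c \in [fset a; b]%fset by rewrite e fset21.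
have /fset2P hd : d \in [fset a; b]%fset by rewrite e fset22.
by intuition congruence.
Qed.

Lemma incidenceC (R : realType) (a : R3 R * R3 R) x y :
  incidence a y x = - incidence a x y.
Proof. by rewrite /incidence opprB. Qed.

Section AntipodalComplex.
Variables (R : realType) (s : seq (R3 R)) (P : set (R3 R)).
Variable o : {fset R3 R} -> R3 R * R3 R.
Variable q : {fset {fset R3 R}} -> (R3 R * R3 R) * (R3 R * R3 R).
Hypothesis PE : P = convex_hull [set` s]%classic.
Hypothesis dimP : full_dimensional P.
Hypothesis ho : orients_pairs P o.
Hypothesis hq : orients_squares P q.
Implicit Types u v w x y : R3 R.

Local Notation vtx := (vtx s).
Local Notation mx := (mx s).
Local Notation m := (nb_pairs P).
Local Notation n := (nb_squares P).
Local Notation k := (nb_vertices P).-1.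
Local Notation D := (boundary_matrix P o q).
Local Notation e_ i := (delta_mx i 0 : 'cV[int]_m).
Local Notation full := (polytope_full PE dimP).

Let pair (i : 'I_m) := nth fset0 (fset_set (antipodal_pairs P)) i.
Let square (j : 'I_n) := nth fset0 (fset_set (antipodal_squares P)) j.
Let vert (i : nat) : R3 R := nth 0 (fset_set (vertices P)) i.

Lemma pairP i : antipodal_pairs P (pair i).
Proof.
have : pair i \in fset_set (antipodal_pairs P) by rewrite mem_nth.
by rewrite in_fset_set ?inE //; apply: finite_antipodal_pairs PE dimP.
Qed.

Lemma pair_inj : injective pair.
Proof.
by move=> i j /eqP; rewrite nth_uniq ?fset_uniq // => /eqP/val_inj.
Qed.

Lemma pair_surj a : antipodal_pairs P a -> exists i, a = pair i.
Proof.
move=> aP; have ain : a \in fset_set (antipodal_pairs P).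
  by rewrite in_fset_set ?inE //; apply: finite_antipodal_pairs PE dimP.
have lt : (index a (fset_set (antipodal_pairs P)) < m)%N by rewrite index_mem.
by exists (Ordinal lt); rewrite /pair nth_index.
Qed.

Lemma squareP j : antipodal_squares P (square j).
Proof.
have : square j \in fset_set (antipodal_squares P) by rewrite mem_nth.
by rewrite in_fset_set ?inE //; apply: finite_antipodal_squares PE dimP.
Qed.

Lemma square_surj a : antipodal_squares P a -> exists i, a = square i.
Proof.
move=> aP; have ain : a \in fset_set (antipodal_squares P).
  by rewrite in_fset_set ?inE //; apply: finite_antipodal_squares PE dimP.
have lt : (index a (fset_set (antipodal_squares P)) < n)%N by rewrite index_mem.
by exists (Ordinal lt); rewrite /square nth_index.
Qed.

Lemma vert_vtx i : (i < nb_vertices P)%N -> vtx (vert i).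
Proof.
move=> lt; have : vert i \in fset_set (vertices P) by rewrite mem_nth.
rewrite in_fset_set ?inE; last exact: finite_vertices PE dimP.
by move/(verticesP PE dimP).
Qed.

Lemma vert_surj v : vtx v -> exists2 i, (i < nb_vertices P)%N & v = vert i.
Proof.
move=> vv; have vin : v \in fset_set (vertices P).
  rewrite in_fset_set ?inE; last exact: finite_vertices PE dimP.
  exact/(verticesP PE dimP).
by exists (index v (fset_set (vertices P))); rewrite ?index_mem // /vert nth_index.
Qed.

Lemma nb_vertices_gt0 : (0 < nb_vertices P)%N.
Proof.
have [v vv _] := exists_vtx full 0; have [i lt _] := vert_surj vv.
exact: leq_trans lt.
Qed.

Lemma anti_neq x y : anti s x y -> x != y.
Proof.
move=> [u [u0 ux uy]]; apply: contraNneq u0 => exy; apply/eqP/full => a b sa sb.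
suff E c : c \in s -> dot u c = dot u x by rewrite (E a) // (E b).
move=> sc; apply/le_anti; rewrite (mx_le ux) //= -lerN2 -!dotNl exy.
by rewrite (mx_le uy).
Qed.

Lemma pair_anti x y : vtx x -> vtx y -> anti s x y -> antipodal_pairs P [fset x; y]%fset.
Proof.
move=> vx vy xy; exists x, y; split; rewrite ?anti_neq //; try exact/(verticesP PE dimP).
exact/(antipodalP PE (vtx_mem vx) (vtx_mem vy)).
Qed.

Lemma orient_pair i : exists x y,
  [/\ o (pair i) = (x, y), pair i = [fset x; y]%fset, vtx x, vtx y & anti s x y].
Proof.
have := ho (pairP i); case: (o (pair i)) => x y /= exy.
have [v [w [/(verticesP PE dimP) vv /(verticesP PE dimP) vw _ vwA evw]]] := pairP i.
have {}vwA := (antipodalP PE (vtx_mem vv) (vtx_mem vw)).1 vwA.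
exists x, y; have := fset2_eq (etrans (esym exy) evw).
by case=> -[? ?]; subst x y; split=> //; apply: anti_sym.
Qed.

(** The tautological cochain; it is zero unless [x] and [y] form an antipodal pair. *)
Definition step x y : 'cV[int]_m := \col_i incidence (o (pair i)) x y.

Lemma stepC x y : step y x = - step x y.
Proof. by apply/colP => i; rewrite !mxE incidenceC. Qed.

Lemma step_orient i x y : o (pair i) = (x, y) -> step x y = e_ i.
Proof.
move=> oi; have [x' [y' [oi' pi vx vy xyA]]] := orient_pair i.
move: oi'; rewrite oi => -[? ?]; subst x' y'.
have xy := anti_neq xyA.
apply/colP => j; rewrite !mxE /incidence andbT.
have [->|ji] := eqVneq j i.
  by rewrite oi eqxx xpair_eqE (negPf xy) /= subr0.
have [a [b [oj pj _ _ _]]] := orient_pair j.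
rewrite oj; have := contra_neq (@pair_inj j i) ji; rewrite pj pi !xpair_eqE => ne.
rewrite (_ : _ && _ = false) 1?(_ : _ && _ = false) ?subrr //.
  by apply: contraNF ne => /andP[/eqP-> /eqP->]; rewrite fsetUC.
by apply: contraNF ne => /andP[/eqP-> /eqP->].
Qed.

Lemma step_anti x y : vtx x -> vtx y -> anti s x y -> exists i,
  (o (pair i) = (x, y) /\ step x y = e_ i) \/ (o (pair i) = (y, x) /\ step x y = - e_ i).
Proof.
move=> vx vy xy; have [i ei] := pair_surj (pair_anti vx vy xy).
exists i; have [a [b [oi pi _ _ _]]] := orient_pair i.
have := fset2_eq (etrans (esym pi) (esym ei)); case=> -[? ?]; subst a b.
  by left; split=> //; apply: step_orient.
by right; split=> //; rewrite -(step_orient oi) stepC.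
Qed.

Definition loop v v' w w' := step v w + step w v' + step v' w' + step w' v.

Lemma loopCl v v' w w' : loop v' v w w' = - loop v v' w w'.
Proof.
rewrite /loop (stepC w v') (stepC v w) (stepC w' v) (stepC v' w').
by apply/colP => i; rewrite !mxE; ring.
Qed.

Lemma loopC v v' w w' : loop w w' v v' = - loop v v' w w'.
Proof.
rewrite /loop (stepC v w) (stepC w' v) (stepC v' w') (stepC w v').
by apply/colP => i; rewrite !mxE; ring.
Qed.

Lemma boundary_delta (j : 'I_n) :
  let: ((v, v'), (w, w')) := q (square j) in D *m delta_mx j 0 = loop v v' w w'.
Proof.
case E : (q (square j)) => [[v v'] [w w']].
by apply/colP => i; rewrite -colE !mxE -/(square j) -/(pair i) E.
Qed.

(** [q] may list the two edges and their ends in any order, but each exchange only changes the sign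
    of the loop. *)
Lemma loop_image v v' w w' : is_edge s v v' -> is_edge s w w' ->
  (exists u, [/\ u != 0, mx u v, mx u v', mx (- u) w & mx (- u) w']) ->
  exists t, loop v v' w w' = D *m t.
Proof.
move=> ev ew uP; have [u [u0 uv uv' uw uw']] := uP.
have sq : antipodal_squares P [fset [fset v; v']; [fset w; w']]%fset.
  exists [fset v; v']%fset, [fset w; w']%fset; split=> //.
  - by apply/(edgesP PE dimP); exists v, v'.
  - by apply/(edgesP PE dimP); exists w, w'.
  - have vw : v != w by apply: anti_neq; exists u.
    have vw' : v != w' by apply: anti_neq; exists u.
    apply: contraNneq vw => /fsetP/(_ v); rewrite !inE eqxx /= => /esym.
    by rewrite (negPf vw') orbF.
  - exact/(antipodal_midpointP PE ev ew).
have [j ej] := square_surj sq.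
have := boundary_delta j; have := hq (squareP j); rewrite -/(square j).
case: (q (square j)) => [[a a'] [b b']]; rewrite -ej => eab Dj.
have img z : (z = D *m delta_mx j 0 \/ z = - (D *m delta_mx j 0)) -> exists t, z = D *m t.
  by case=> ->; [exists (delta_mx j 0)|exists (- delta_mx j 0); rewrite mulmxN].
apply: img; rewrite Dj.
have loopCr c c' d d' : loop c c' d' d = - loop c c' d d'.
  by rewrite (loopC d' d) (loopC d d') (loopCl d d').
case: (fset2_eq eab) => -[/fset2_eq ea /fset2_eq eb].
  by case: ea => -[-> ->]; case: eb => -[-> ->]; rewrite ?(loopCl a) ?(loopCr _ _ b);
    rewrite ?opprK; (by left) || by right.
by case: ea => -[-> ->]; case: eb => -[-> ->];
  rewrite loopC ?(loopCl a) ?(loopCr _ _ b); rewrite ?opprK; (by left) || by right.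
Qed.

Lemma column_loop (j : 'I_n) : exists v v' w w',
  D *m delta_mx j 0 = loop v v' w w' /\
  [/\ vtx v, vtx v', vtx w & vtx w'] /\
  [/\ anti s v w, anti s w v', anti s v' w' & anti s w' v].
Proof.
have := boundary_delta j; have := hq (squareP j); rewrite -/(square j).
case: (q (square j)) => [[v v'] [w w']] esq Dj; exists v, v', w, w'; split=> //.
have [e [f [/(edgesP PE dimP)[a [a' [ea ee]]] /(edgesP PE dimP)[b [b' [eb ef]]] _ ab
  e2]]] := squareP j.
move: ab; rewrite ee ef => /(antipodal_midpointP PE ea eb)[u [u0 ua ua' ub ub']].
have [_ va va' _] := ea; have [_ vb vb' _] := eb.
have key c c' d d' : mx u c -> mx u c' -> mx (- u) d -> mx (- u) d' ->
    [/\ anti s c d, anti s d c', anti s c' d' & anti s d' c].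
  by move=> *; split; try (by exists u); apply: anti_sym; exists u.
have keyN c c' d d' : mx u c -> mx u c' -> mx (- u) d -> mx (- u) d' ->
    [/\ anti s d c, anti s c d', anti s d' c' & anti s c' d].
  by move=> *; split; try (by exists u); apply: anti_sym; exists u.
case: (fset2_eq (etrans (esym esq) e2)); rewrite ee ef => -[/fset2_eq h1 /fset2_eq h2].
  by case: h1 => -[-> ->]; case: h2 => -[-> ->]; split; try exact: key.
by case: h1 => -[-> ->]; case: h2 => -[-> ->]; split; try exact: keyN.
Qed.

(* The vertex [vert 0] is dropped from the boundary map to make it onto. *)
Definition coord v : 'cV[int]_k := \col_i (vert i.+1 == v)%:R.

Definition graph_boundary : 'M[int]_(k, m) :=
  \matrix_(i, j) (coord (o (pair j)).2 - coord (o (pair j)).1) i 0.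

Local Notation bd := graph_boundary.
Local Notation par := (const_mx 1 : 'rV[int]_m).

Lemma bd_step x y : vtx x -> vtx y -> anti s x y -> bd *m step x y = coord y - coord x.
Proof.
move=> vx vy xy; have [i] := step_anti vx vy xy.
have bdi : bd *m e_ i = coord (o (pair i)).2 - coord (o (pair i)).1.
  by apply/colP => j; rewrite -colE !mxE.
by case=> -[oi ->]; rewrite ?mulmxN bdi oi //= opprB.
Qed.

Lemma par_step x y : vtx x -> vtx y -> anti s x y ->
  (par *m step x y) 0 0 = 1 \/ (par *m step x y) 0 0 = -1.
Proof.
move=> vx vy xy; have [i] := step_anti vx vy xy.
have pi : (par *m e_ i) 0 0 = 1 by rewrite -colE !mxE.
by case=> -[_ ->]; [left|right; rewrite mulmxN mxE pi].
Qed.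

Lemma bd_boundary : bd *m D = 0.
Proof.
apply/matrixP => i j; have [v [v' [w [w' [Dj [[? ? ? ?] [? ? ? ?]]]]]]] := column_loop j.
have bl : bd *m loop v v' w w' = 0.
  by rewrite /loop !mulmxDr !bd_step //; apply/colP => l; rewrite !mxE; ring.
have /colP/(_ i) : bd *m (D *m (delta_mx j 0 : 'cV_n)) = 0 by rewrite Dj.
by rewrite mulmxA -colE !mxE.
Qed.

(** The boundary of a square is a sum of four steps, each of odd parity. *)
Lemma par_boundary (x : 'cV_n) : (2 %| ((par *m (D *m x)) 0 0)%R)%Z.
Proof.
suff H (j : 'I_n) : (2 %| ((par *m D) 0 j)%R)%Z.
  by rewrite mulmxA mxE; apply: rpred_sum => j _; rewrite dvdz_mulr.
have [v [v' [w [w' [Dj [[vv vv' vw vw'] [a1 a2 a3 a4]]]]]]] := column_loop j.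
have -> : (par *m D) 0 j = (par *m (D *m (delta_mx j 0 : 'cV_n))) 0 0.
  by rewrite mulmxA -colE [RHS]mxE.
have addE (t z : 'cV[int]_m) : (par *m (t + z)) 0 0 = (par *m t) 0 0 + (par *m z) 0 0.
  by rewrite mulmxDr mxE.
have p1 := par_step vv vw a1; have p2 := par_step vw vv' a2.
have p3 := par_step vv' vw' a3; have p4 := par_step vw' vv a4.
rewrite Dj /loop !addE.
by case: p1 => ->; case: p2 => ->; case: p3 => ->; case: p4 => ->.
Qed.

Lemma coord_vert0 : coord (vert 0) = 0.
Proof.
apply/colP => i; rewrite !mxE nth_uniq ?fset_uniq //.
  by rewrite -ltn_predRL; case: i.
exact: nb_vertices_gt0.
Qed.

Lemma coord_vertS (i : 'I_k) : coord (vert i.+1) = delta_mx i 0.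
Proof.
apply/colP => j; rewrite !mxE nth_uniq ?fset_uniq ?andbT //.
  by rewrite -ltn_predRL; case: j.
by rewrite -ltn_predRL; case: i.
Qed.

(* Taking steps modulo square boundaries is a flat cochain with values in the
   cokernel; it is split by potentials, which cancel along a cycle. *)
Lemma even_cycle_image (x : 'cV_m) : bd *m x = 0 -> (2 %| ((par *m x) 0 0)%R)%Z ->
  exists t, x = D *m t.
Proof.
move=> bx px; apply/coker_pi_eq0.
have [||a [t [tt aP]]] := @antisym_split R s full (coker D) (fun v w => coker_pi D (step v w)).
- by move=> v w; rewrite stepC raddfN.
- by move=> v v' w w' ev ew uP; rewrite -!raddfD; apply/coker_pi_eq0/loop_image.
(* Normalised to vanish at [vert 0], the potential is a linear function of [coord]. *)
pose b v := a v - a (vert 0).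
have bE v : vtx v -> b v = \sum_(i < k) b (vert i.+1) *~ coord v i 0.
  move=> /vert_surj[[|i] lt ->].
    by rewrite {1}/b subrr big1 // => i _; rewrite coord_vert0 mxE mulr0z.
  have ik : (i < k)%N by rewrite ltn_predRL.
  rewrite (bigD1 (Ordinal ik)) //= (coord_vertS (Ordinal ik)) mxE !eqxx big1 ?addr0 //.
  by move=> l li; rewrite mxE (negPf li).
have piE i : coker_pi D (e_ i) = t - \sum_(l < k) b (vert l.+1) *~ bd l i.
  have [v [w [oi _ vv vw vwA]]] := orient_pair i.
  rewrite -(step_orient oi) aP // [RHS]addrC; congr (_ + _).
  have -> : a v - a w = b v - b w by rewrite /b opprB addrA subrK.
  rewrite (bE v) // (bE w) // -opprB; congr (- _); rewrite -sumrB.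
  by apply: eq_bigr => l _; rewrite [bd l i]mxE oi /= -mulrzBr; congr (_ *~ _); rewrite !mxE.
have xE : x = \sum_i e_ i *~ x i 0.
  apply/colP => j; rewrite summxE (bigD1 j) //= -scaler_int !mxE !eqxx mulr1 big1
    ?addr0 ?intz //.
  by move=> i ij; rewrite -scaler_int !mxE eq_sym (negPf ij) mulr0.
rewrite {1}xE raddf_sum /=.
under eq_bigr => i _ do rewrite raddfMz /= piE mulrzBl.
rewrite sumrB -mulrz_sumr (_ : \sum_i x i 0 = (par *m x) 0 0); last first.
  by rewrite mxE; apply: eq_bigr => i _; rewrite mxE mul1r.
have /dvdzP[p ->] := px; have -> : t *~ (p * 2) = (t + t) *~ p by rewrite mulrC mulrzA.
rewrite tt mul0rz.
under eq_bigr => i _ do rewrite mulrz_suml.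
rewrite exchange_big big1 ?subrr //= => l _.
transitivity (b (vert l.+1) *~ (bd *m x) l 0); last by rewrite bx mxE mulr0z.
by rewrite mxE mulrz_sumr; apply: eq_bigr => i _; rewrite mulrzA.
Qed.

(** Walks of even length, relaxed to chains. *)
Definition even_linked v w := exists2 z : 'cV[int]_m,
  bd *m z = coord w - coord v & (2 %| ((par *m z) 0 0)%R)%Z.

(** Cofacial vertices are linked by two steps through a common antipode. [cofacial_const] is applied
    to the map sending a vertex to its class, a predicate. *)
Lemma even_linked_all v w : vtx v -> vtx w -> even_linked v w.
Proof.
have refl x : even_linked x x by exists 0; rewrite !mulmx0 ?subrr // mxE dvdz0.
have sym x y : even_linked x y -> even_linked y x.
  by move=> [z bz pz]; exists (- z); rewrite !mulmxN ?bz ?opprB // mxE rpredN.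
have trans x y z : even_linked x y -> even_linked y z -> even_linked x z.
  move=> [a ba pa] [b bb pb]; exists (a + b); rewrite !mulmxDr.
    by rewrite ba bb addrC addrA subrK.
  by rewrite mxE rpredD.
move=> vv vw; suff -> : even_linked v = even_linked w by exact: refl.
apply: (cofacial_const full _ vv vw) => u x y u0 vx vy ux uy.
apply/funext => z; apply/propext.
suff xy : even_linked x y by split; apply: trans => //; apply: sym.
have [t vt ut] := exists_vtx full (- u).
have xt : anti s x t by exists u.
have yt : anti s y t by exists u.
exists (step x t - step y t).
  by rewrite mulmxBr !bd_step //; apply/colP => l; rewrite !mxE; ring.
rewrite mulmxBr [X in (_ %| X)%Z]mxE [X in _ + X]mxE; have := par_step vx vt xt;
  have := par_step vy vt yt.
by do 2 case=> ->.
Qed.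

Lemma bd_onto : exists S : 'M[int]_(m, k), bd *m S = 1%:M.
Proof.
have /choice[z zP] (i : 'I_k) : exists z : 'cV[int]_m, bd *m z = delta_mx i 0.
  have [||z bz _] := @even_linked_all (vert 0) (vert i.+1).
  - exact: vert_vtx nb_vertices_gt0.
  - by apply: vert_vtx; rewrite -ltn_predRL.
  by exists z; rewrite bz coord_vert0 subr0 coord_vertS.
exists (\matrix_(i, j) z j i 0); apply/matrixP => i j.
have /colP/(_ i) := zP j; rewrite !mxE andbT => <-.
by apply: eq_bigr => l _; congr (_ * _); rewrite mxE.
Qed.

(** A single antipodal step is closed up by an even chain. *)
Lemma odd_cycle : exists2 x : 'cV[int]_m,
  bd *m x = 0 & ~~ (2 %| ((par *m x) 0 0)%R)%Z.
Proof.
have c0 : const_mx 1 != 0 :> R3 R.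
  by apply/eqP => /rowP/(_ 0)/eqP; rewrite !mxE oner_eq0.
have [v vv mv] := exists_vtx full (const_mx 1).
have [w vw mw] := exists_vtx full (- const_mx 1).
have vwA : anti s v w by exists (const_mx 1).
have [z bz pz] := even_linked_all vw vv.
exists (step v w + z); rewrite mulmxDr; first by rewrite bd_step // bz addrA subrK subrr.
rewrite mxE rpredDr //; by case: (par_step vv vw vwA) => ->.
Qed.

End AntipodalComplex.

Lemma sorted_rcons_ones p : sorted dvdz (rcons (nseq p 1) 2).
Proof.
by case: p => // p /=; elim: p.
Qed.

Theorem theorem9p3 (R : realType) (P : set (R3 R))
    (o : {fset R3 R} -> R3 R * R3 R)
    (q : {fset {fset R3 R}} -> (R3 R * R3 R) * (R3 R * R3 R))
    (hP : polytope P) (hdim : full_dimensional P)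
    (ho : orients_pairs P o) (hq : orients_squares P q) :
  let D := boundary_matrix P o q in
  [/\ (exists2 d : nat, d%:Z = defect P & zmod_isomorphic (ker D) 'cV[int]_d),
      zmod_isomorphic (coker D) ('cV[int]_(nb_vertices P).-1 * 'Z_2)%type
    & exists2 r : nat, r%:Z = (nb_pairs P)%:Z - (nb_vertices P)%:Z + 1 &
        (0 < r)%N /\ nonzero_invariant_factors D (rcons (nseq r.-1 1) 2)].
Proof.
move=> D; have [s PE] := hP.
have V0 := nb_vertices_gt0 PE hdim.
have bdD := bd_boundary PE hdim ho hq.
have parD := par_boundary PE hdim ho hq.
have exactD := even_cycle_image PE hdim ho hq.
have onto := bd_onto PE hdim ho.
have odd := odd_cycle PE hdim ho.
have [r [r0 rn rk [L [N [Lu Nu DE]]]]] := parity_exact_smith bdD parD exactD onto odd.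
have sz : size (rcons (nseq r.-1 1%Z) 2) = r by rewrite size_rcons size_nseq prednK.
have rm : (r <= nb_pairs P)%N by rewrite -rk leq_addr.
split; last 1 first.
- exists r; first by rewrite -rk PoszD; lia.
  split=> //; split; first by rewrite sz leq_min rm rn.
  + by rewrite all_rcons all_nseq orbT.
  + exact: sorted_rcons_ones.
  + by exists L, N; split.
(* As [r <= nb_squares P], the subtraction is exact, and the rank relation [rk] identifies it with
   the defect. *)
- exists (nb_squares P - r)%N; first by rewrite /defect -rk PoszD; lia.
  apply: (smith_ker_isomorphic rn rm Lu Nu sz _ DE).
  by rewrite all_rcons all_nseq orbT.
- exact: parity_exact_coker bdD parD exactD onto odd.
Qed.
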